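(* Let $k$ be a commutative ring with unit. The category of abelian affine $k$-monoids $G=\mathrm{Spec}\, A$ (where $A$ is a commutative $k$-algebra that is a projective $k$-module) is anti-equivalent to the category of functors of abelian monoids of the form $\mathrm{Spec}\,\mathbf{C}^*$ (where $\mathbf{C}^*$ is a commutative $k$-algebra scheme with $C$ a projective $k$-module). The functors giving the anti-equivalence are, in both directions, those that assign to each functor of monoids $H$ its dual functor of monoids $H^*=\mathbf{Hom}_{monoids}(H,\mathbf{k})$.
   Context: All functors are covariant functors on the category of commutative $k$-algebras. A functor of $k$-modules is a functor $F$ such that each $F(B)$ is a $B$-module, compatibly with base change (for $B\to B'$ the map $F(B)\to F(B')$ is $B$-linear); morphisms are natural transformations that are $B$-linear for every $B$. A functor of $k$-algebras is a functor of $k$-modules $\mathcal A$ such that each $\mathcal A(B)$ is an associative unital $B$-algebra, compatibly; $\mathrm{Hom}_{k\text{-}alg}$ denotes morphisms of such functors. For a $k$-module $E$, $\mathbf{E}$ is the functor $\mathbf{E}(B)=E\otimes_k B$; in particular $\mathbf{k}(B)=B$. For functors of $k$-modules $F,H$, $\mathbf{Hom}_k(F,H)(B)=\mathrm{Hom}_B(F_{|B},H_{|B})$, where $F_{|B}$ is the restriction of $F$ to commutative $B$-algebras. The dual of a functor of $k$-modules $F$ is $F^*=\mathbf{Hom}_k(F,\mathbf{k})$. A commutative $k$-algebra scheme is a functor of commutative $k$-algebras whose underlying functor of $k$-modules is $\mathbf{C}^*$ for a $k$-module $C$ (equivalently, $C$ is a cocommutative $k$-coalgebra). For a functor of $k$-algebras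 $\mathcal A$, $\mathrm{Spec}\,\mathcal A$ is the functor of sets $(\mathrm{Spec}\,\mathcal A)(B)=\mathrm{Hom}_{k\text{-}alg}(\mathcal A,\mathbf{B})$. For a commutative $k$-algebra $A$, the scheme $\mathrm{Spec}\,A$ is identified with its functor of points $\mathrm{Spec}\,\mathbf{A}$. For a functor of monoids $H$, the dual functor of monoids is $H^*(B)=\mathbf{Hom}_{monoids}(H,\mathbf{k})(B)=\mathrm{Hom}_{monoids}(H_{|B},\mathbf{k}_{|B})$, where $\mathbf{k}$ is a functor of monoids by multiplication, and $H^*$ is an abelian monoid by pointwise multiplication. In both categories the morphisms are the morphisms of functors of monoids. *)

(* Defs.v *)
From HB Require Import structures.
From mathcomp Require Import all_boot all_algebra.
From mathcomp Require Import boolp.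

Set Implicit Arguments.
Unset Strict Implicit.
Unset Printing Implicit Defensive.

Import GRing.Theory.
Local Open Scope ring_scope.
Local Open Scope quotient_scope.

(* The zero ring is allowed, both as base ring and as algebra; the library's
   [comAlgType] requires 1 != 0 and would exclude it. *)
Record calg (k : comPzRingType) := CAlg {
  alg_ring :> comPzRingType;
  alg_map : {rmorphism k -> alg_ring}
}.

Record calg_hom (k : comPzRingType) (A B : calg k) := CAlgHom {
  calg_fun :> {rmorphism A -> B};
  calg_funE : forall r, calg_fun (alg_map A r) = alg_map B r
}.

Lemma rmorphism_eq (R S : pzRingType) (f g : {rmorphism R -> S}) :
  f =1 g -> f = g.
Proof.
case: f g => [f [[fA] [[f1 fM]]]] [g [[gA] [[g1 gM]]]] /= /funext fg; subst g.
by rewrite (Prop_irrelevance fA gA) (Prop_irrelevance f1 g1)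
  (Prop_irrelevance fM gM).
Qed.

Lemma calg_hom_eq (k : comPzRingType) (A B : calg k) (f g : calg_hom A B) :
  f =1 g -> f = g.
Proof.
case: f g => [f fE] [g gE] /= /rmorphism_eq fg; subst g.
by rewrite (Prop_irrelevance fE gE).
Qed.

Definition calg_id (k : comPzRingType) (A : calg k) : calg_hom A A :=
  @CAlgHom k A A (@idfun A) (fun=> erefl).

Definition calg_comp (k : comPzRingType) (A B C : calg k)
    (g : calg_hom B C) (f : calg_hom A B) : calg_hom A C.
Proof.
exists (g \o f : {rmorphism A -> C}) => r.
by rewrite /= !calg_funE.
Defined.

Lemma calg_compA (k : comPzRingType) (A B C D : calg k)
    (h : calg_hom C D) (g : calg_hom B C) (f : calg_hom A B) :
  calg_comp h (calg_comp g f) = calg_comp (calg_comp h g) f.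
Proof. exact: calg_hom_eq. Qed.

Lemma calg_comp1f (k : comPzRingType) (A B : calg k) (f : calg_hom A B) :
  calg_comp (calg_id B) f = f.
Proof. exact: calg_hom_eq. Qed.

Lemma calg_compf1 (k : comPzRingType) (A B : calg k) (f : calg_hom A B) :
  calg_comp f (calg_id A) = f.
Proof. exact: calg_hom_eq. Qed.

Definition alg_mod (k : comPzRingType) (A : calg k) : Type := A.

Section AlgebraAsModule.
Variables (k : comPzRingType) (A : calg k).
HB.instance Definition _ := GRing.Zmodule.on (alg_mod A).

Let scale (r : k) (a : alg_mod A) : alg_mod A := (alg_map A r : A) * (a : A).
Fact alg_scalerA a b v : scale a (scale b v) = scale (a * b) v.
Proof. by rewrite /scale mulrA -rmorphM. Qed.
Fact alg_scale1r : left_id 1 scale.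
Proof. by move=> v; rewrite /scale rmorph1 mul1r. Qed.
Fact alg_scalerDr : right_distributive scale +%R.
Proof. by move=> r u v; rewrite /scale -mulrDr. Qed.
Fact alg_scalerDl v : {morph scale^~ v : a b / a + b}.
Proof. by move=> a b; rewrite /scale rmorphD mulrDl. Qed.

HB.instance Definition _ := GRing.Zmodule_isLmodule.Build k (alg_mod A)
  alg_scalerA alg_scale1r alg_scalerDr alg_scalerDl.

Lemma alg_scaleE (r : k) (a : alg_mod A) :
  r *: a = (alg_map A r : A) * (a : A) :> A.
Proof. by []. Qed.
End AlgebraAsModule.

Definition projective (k : comPzRingType) (P : lmodType k) : Prop :=
  forall (M N : lmodType k) (g : {linear M -> N}) (f : {linear P -> N}),
    (forall y, exists x, g x = y) ->
    exists h : {linear P -> M}, forall x, g (h x) = f x.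

(** Base change E (x)_k B, as formal sums of pairs modulo the congruence
    generated by bilinearity and k-balancedness. *)

Section Tensor.
Variables (k : comPzRingType) (E : lmodType k) (B : calg k).

Inductive tens_rel : seq (E * B) -> seq (E * B) -> Prop :=
| TensRefl s : tens_rel s s
| TensSym s t : tens_rel s t -> tens_rel t s
| TensTrans s t u : tens_rel s t -> tens_rel t u -> tens_rel s u
| TensCat s s' t t' :
    tens_rel s s' -> tens_rel t t' -> tens_rel (s ++ t) (s' ++ t')
| TensC s t : tens_rel (s ++ t) (t ++ s)
| TensDl e e' b : tens_rel [:: (e + e', b)] [:: (e, b); (e', b)]
| TensDr e b b' : tens_rel [:: (e, b + b')] [:: (e, b); (e, b')]
| TensZ r e b : tens_rel [:: (r *: e, b)] [:: (e, alg_map B r * b)]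
| Tens0 b : tens_rel [:: (0, b)] [::].

Definition tens_relb (s t : seq (E * B)) : bool := `[< tens_rel s t >].

Fact tens_relb_refl : reflexive tens_relb.
Proof. by move=> s; apply/asboolP; apply: TensRefl. Qed.
Fact tens_relb_sym : symmetric tens_relb.
Proof. by move=> s t; apply/asboolP/asboolP; apply: TensSym. Qed.
Fact tens_relb_trans : transitive tens_relb.
Proof.
by move=> t s u /asboolP st /asboolP tu; apply/asboolP; apply: TensTrans st tu.
Qed.

Canonical tens_equiv :=
  EquivRel tens_relb tens_relb_refl tens_relb_sym tens_relb_trans.

Definition tensor : Type := {eq_quot tens_equiv}.
HB.instance Definition _ := Choice.on tensor.

Definition tens_of (s : seq (E * B)) : tensor := \pi_({eq_quot tens_equiv}) s.
Definition tens_repr (x : tensor) : seq (E * B) :=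
  repr (x : {eq_quot tens_equiv}).
Definition pure (e : E) (b : B) : tensor := tens_of [:: (e, b)].

Lemma tens_ofE s t : tens_of s = tens_of t <-> tens_rel s t.
Proof.
split=> [/eqmodP|st]; first by move=> /= /asboolP.
by apply/eqmodP => /=; apply/asboolP.
Qed.

Lemma tens_reprK x : tens_of (tens_repr x) = x.
Proof. exact: reprK. Qed.

Lemma tens_ofK s : tens_rel (tens_repr (tens_of s)) s.
Proof. by apply/tens_ofE; rewrite tens_reprK. Qed.

Definition tens_zero : tensor := tens_of [::].
Definition tens_add (x y : tensor) : tensor :=
  tens_of (tens_repr x ++ tens_repr y).

Lemma tens_of_cat s t : tens_of (s ++ t) = tens_add (tens_of s) (tens_of t).
Proof. by apply/tens_ofE/TensCat; apply/TensSym/tens_ofK. Qed.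

Fact tens_addA : associative tens_add.
Proof.
move=> x y z; rewrite -[x]tens_reprK -[y]tens_reprK -[z]tens_reprK.
by rewrite -!tens_of_cat catA.
Qed.
Fact tens_addC : commutative tens_add.
Proof.
move=> x y; rewrite -[x]tens_reprK -[y]tens_reprK -!tens_of_cat.
by apply/tens_ofE/TensC.
Qed.
Fact tens_add0 : left_id tens_zero tens_add.
Proof. by move=> x; rewrite -[x]tens_reprK -tens_of_cat. Qed.

HB.instance Definition _ :=
  GRing.isNmodule.Build tensor tens_addA tens_addC tens_add0.

Lemma tens_of_sum s : tens_of s = \sum_(p <- s) pure p.1 p.2.
Proof.
elim: s => [|[e b] s IHs];
  first by rewrite big_nil.
by rewrite big_cons -IHs -[(e, b) :: s]cat1s tens_of_cat.
Qed.

Lemma pureDl e e' b : pure (e + e') b = pure e b + pure e' b.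
Proof. by rewrite /pure -[RHS]tens_of_cat; apply/tens_ofE/TensDl. Qed.
Lemma pureDr e b b' : pure e (b + b') = pure e b + pure e b'.
Proof. by rewrite /pure -[RHS]tens_of_cat; apply/tens_ofE/TensDr. Qed.
Lemma pureZ r e b : pure (r *: e) b = pure e (alg_map B r * b).
Proof. by apply/tens_ofE/TensZ. Qed.
Lemma pure0l b : pure 0 b = 0.
Proof. by apply/tens_ofE/Tens0. Qed.
Lemma pure0r e : pure e 0 = 0.
Proof.
by rewrite -[X in pure _ X](mul0r 0) -(rmorph0 (alg_map B)) -pureZ scale0r pure0l.
Qed.

Lemma tens_ind (P : tensor -> Prop) :
  P 0 -> (forall x y, P x -> P y -> P (x + y)) ->
  (forall e b, P (pure e b)) -> forall x, P x.
Proof.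
move=> P0 PD Pp x; rewrite -[x]tens_reprK tens_of_sum.
by apply: big_ind => // p _; apply: Pp.
Qed.

Record balanced (V : nmodType) (phi : E -> B -> V) : Prop := Balanced {
  balDl : forall e e' b, phi (e + e') b = phi e b + phi e' b;
  balDr : forall e b b', phi e (b + b') = phi e b + phi e b';
  balZ : forall r e b, phi (r *: e) b = phi e (alg_map B r * b);
  bal0 : forall b, phi 0 b = 0
}.

Definition tens_lift (V : nmodType) (phi : E -> B -> V) (x : tensor) : V :=
  \sum_(p <- tens_repr x) phi p.1 p.2.

Section Lift.
Variables (V : nmodType) (phi : E -> B -> V).
Hypothesis phiB : balanced phi.

Lemma tens_rel_sum s t : tens_rel s t ->
  \sum_(p <- s) phi p.1 p.2 = \sum_(p <- t) phi p.1 p.2.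
Proof.
elim=> {s t} //=.
- by move=> ? ? ? _ -> _ ->.
- by move=> ? ? ? ? _ IH1 _ IH2; rewrite !big_cat /= IH1 IH2.
- by move=> ? ?; rewrite !big_cat /= addrC.
- by move=> ? ? ?; rewrite !big_cons !big_nil /= balDl ?addr0 ?addrA.
- by move=> ? ? ?; rewrite !big_cons !big_nil /= balDr ?addr0 ?addrA.
- by move=> ? ? ?; rewrite !big_cons !big_nil /= balZ.
- by move=> ?; rewrite !big_cons !big_nil /= bal0 ?addr0.
Qed.

Lemma tens_lift_of s : tens_lift phi (tens_of s) = \sum_(p <- s) phi p.1 p.2.
Proof. exact: tens_rel_sum (tens_ofK s). Qed.

Lemma tens_lift_pure e b : tens_lift phi (pure e b) = phi e b.
Proof. by rewrite tens_lift_of big_seq1. Qed.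
Lemma tens_lift0 : tens_lift phi 0 = 0.
Proof. by rewrite tens_lift_of big_nil. Qed.
Lemma tens_liftD x y :
  tens_lift phi (x + y) = tens_lift phi x + tens_lift phi y.
Proof.
rewrite -[x]tens_reprK -[y]tens_reprK -[_ + _]tens_of_cat.
by rewrite !tens_lift_of big_cat.
Qed.
End Lift.

Definition tens_opp : tensor -> tensor := tens_lift (fun e b => pure (- e) b).
Fact tens_opp_bal : balanced (fun e b => pure (- e) b).
Proof.
split=> [e e' b|e b b'|r e b|b];
  first by rewrite opprD pureDl.
- exact: pureDr.
- by rewrite -scalerN pureZ.
- by rewrite oppr0 pure0l.
Qed.
Fact tens_addN : left_inverse (0 : tensor) tens_opp +%R.
Proof.
apply: tens_ind => [|x y IHx IHy|e b]; rewrite /tens_opp.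
- by rewrite (tens_lift0 tens_opp_bal) addr0.
- by rewrite (tens_liftD tens_opp_bal) addrACA IHx IHy addr0.
- by rewrite (tens_lift_pure tens_opp_bal) -pureDl addNr pure0l.
Qed.

HB.instance Definition _ := GRing.Nmodule_isZmodule.Build tensor tens_addN.

Definition tens_scale (c : B) : tensor -> tensor :=
  tens_lift (fun e b => pure e (c * b)).
Fact tens_scale_bal c : balanced (fun e b => pure e (c * b)).
Proof.
split=> [e e' b|e b b'|r e b|b]; first exact: pureDl.
- by rewrite mulrDr pureDr.
- by rewrite pureZ mulrCA.
- exact: pure0l.
Qed.
Lemma tens_scale_pure c e b : tens_scale c (pure e b) = pure e (c * b).
Proof. exact: (tens_lift_pure (tens_scale_bal c)). Qed.
Fact tens_scaleDr : right_distributive tens_scale +%R.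
Proof. by move=> c; apply: (tens_liftD (tens_scale_bal c)). Qed.
Let tens_scale0 c : tens_scale c 0 = 0.
Proof. exact: (tens_lift0 (tens_scale_bal c)). Qed.
Fact tens_scaleA c d x : tens_scale c (tens_scale d x) = tens_scale (c * d) x.
Proof.
move: x; apply: tens_ind => [|x y IHx IHy|e b];
  first by rewrite !tens_scale0.
  by rewrite !tens_scaleDr IHx IHy.
by rewrite !tens_scale_pure mulrA.
Qed.
Fact tens_scale1 : left_id 1 tens_scale.
Proof.
apply: tens_ind => [|x y IHx IHy|e b]; first exact: tens_scale0.
  by rewrite !tens_scaleDr IHx IHy.
by rewrite tens_scale_pure mul1r.
Qed.
Fact tens_scaleDl x : {morph tens_scale^~ x : c d / c + d}.
Proof.
move=> c d; move: x; apply: tens_ind => [|x y IHx IHy|e b].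
- by rewrite !tens_scale0 addr0.
- by rewrite !tens_scaleDr IHx IHy addrACA.
- by rewrite !tens_scale_pure mulrDl pureDr.
Qed.

HB.instance Definition _ := GRing.Zmodule_isLmodule.Build B tensor
  tens_scaleA tens_scale1 tens_scaleDr tens_scaleDl.

Lemma tensZ_pure (c : B) e b : c *: pure e b = pure e (c * b).
Proof. exact: tens_scale_pure. Qed.
End Tensor.

Arguments pure {k E B} e b.
Arguments tens_ind [k E B].

Section TensorMap.
Variables (k : comPzRingType) (E E' : lmodType k) (B B' : calg k).
Variables (f : {linear E -> E'}) (g : calg_hom B B').

Definition tens_map : tensor E B -> tensor E' B' :=
  tens_lift (fun e b => pure (f e) (g b)).

Fact tens_map_bal : balanced (fun e b => pure (f e) (g b) : tensor E' B').
Proof.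
split=> [e e' b|e b b'|r e b|b];
  first by rewrite linearD pureDl.
- by rewrite rmorphD pureDr.
- by rewrite linearZ /= pureZ rmorphM calg_funE.
- by rewrite linear0 pure0l.
Qed.
Lemma tens_map_pure e b : tens_map (pure e b) = pure (f e) (g b).
Proof. exact: (tens_lift_pure tens_map_bal). Qed.
Lemma tens_map0 : tens_map 0 = 0.
Proof. exact: (tens_lift0 tens_map_bal). Qed.
Lemma tens_mapD x y : tens_map (x + y) = tens_map x + tens_map y.
Proof. exact: (tens_liftD tens_map_bal). Qed.
Lemma tens_mapZ c x : tens_map (c *: x) = g c *: tens_map x.
Proof.
move: x; apply: tens_ind => [|x y IHx IHy|e b];
  first by rewrite !(scaler0, tens_map0).
  by rewrite scalerDr !tens_mapD IHx IHy scalerDr.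
by rewrite tensZ_pure !tens_map_pure tensZ_pure rmorphM.
Qed.
End TensorMap.

Section TensorAlgebra.
Variables (k : comPzRingType) (A B : calg k).
Local Notation T := (tensor (alg_mod A) B).

Definition tens_mul (x y : T) : T :=
  tens_lift (fun (a : alg_mod A) (b : B) =>
    tens_lift (fun (a' : alg_mod A) (b' : B) =>
    (pure ((a : A) * (a' : A) : alg_mod A) (b * b') : T)) y) x.

Fact tens_mul_bal2 (a : alg_mod A) (b : B) :
  balanced (fun (a' : alg_mod A) (b' : B) =>
  (pure ((a : A) * (a' : A) : alg_mod A) (b * b') : T)).
Proof.
split=> [e e' c|e c c'|r e c|c].
- by rewrite -pureDl -mulrDr.
- by rewrite mulrDr pureDr.
- by rewrite [b * (_ * c)]mulrCA -pureZ /= !alg_scaleE mulrCA.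
- by rewrite mulr0 pure0l.
Qed.

Fact tens_mul_bal1 (y : T) : balanced (fun (a : alg_mod A) (b : B) =>
  tens_lift (fun (a' : alg_mod A) (b' : B) =>
    (pure ((a : A) * (a' : A) : alg_mod A) (b * b') : T)) y).
Proof.
have bal := tens_mul_bal2.
split=> [e e' b|e b b'|r e b|b]; move: y; apply: tens_ind => [|x y IHx IHy|e1 b1];
  rewrite ?(tens_lift0 (bal _ _)) ?(tens_liftD (bal _ _))
    ?(tens_lift_pure (bal _ _)) ?addr0 //.
- by rewrite IHx IHy addrACA.
- by rewrite -pureDl -mulrDl.
- by rewrite IHx IHy addrACA.
- by rewrite mulrDl pureDr.
- by rewrite IHx IHy.
- by rewrite -mulrA -pureZ !alg_scaleE mulrA.
- by rewrite IHx IHy addr0.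
- by rewrite mul0r pure0l.
Qed.

Lemma tens_mul_pure (a a' : alg_mod A) (b b' : B) :
  tens_mul (pure a b) (pure a' b') =
  pure ((a : A) * (a' : A) : alg_mod A) (b * b').
Proof.
by rewrite /tens_mul (tens_lift_pure (tens_mul_bal1 _))
  (tens_lift_pure (tens_mul_bal2 _ _)).
Qed.

Let mul0 : left_zero 0 tens_mul.
Proof. by move=> y; apply: (tens_lift0 (tens_mul_bal1 y)). Qed.
Fact tens_mulDl : left_distributive tens_mul +%R.
Proof. by move=> x x' y; apply: (tens_liftD (tens_mul_bal1 y)). Qed.
Fact tens_mulC : commutative tens_mul.
Proof.
have mulx0 : right_zero 0 tens_mul.
  move=> x; move: x; apply: tens_ind => [|x x' IHx IHx'|a b]; first exact: mul0.
    by rewrite tens_mulDl IHx IHx' addr0.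
  by rewrite /tens_mul (tens_lift_pure (tens_mul_bal1 _))
    (tens_lift0 (tens_mul_bal2 _ _)).
have mulDr : right_distributive tens_mul +%R.
  move=> x y y'; move: x; apply: tens_ind => [|x x' IHx IHx'|a b].
  - by rewrite !mul0 addr0.
  - by rewrite !tens_mulDl IHx IHx' addrACA.
  - by rewrite /tens_mul !(tens_lift_pure (tens_mul_bal1 _))
      (tens_liftD (tens_mul_bal2 _ _)).
move=> x y; move: x; apply: tens_ind => [|x x' IHx IHx'|a b].
- by rewrite mul0 mulx0.
- by rewrite tens_mulDl IHx IHx' mulDr.
move: y; apply: tens_ind => [|y y' IHy IHy'|a' b'];
  first by rewrite mul0 mulx0.
  by rewrite tens_mulDl mulDr IHy IHy'.
by rewrite !tens_mul_pure [(a : A) * _]mulrC [b * _]mulrC.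
Qed.
Fact tens_mulA : associative tens_mul.
Proof.
have mulx0 : right_zero 0 tens_mul by move=> x; rewrite tens_mulC mul0.
have mulDr : right_distributive tens_mul +%R.
  by move=> x y y'; rewrite !(tens_mulC x) tens_mulDl.
move=> x y z; move: x; apply: tens_ind => [|x x' IHx IHx'|a b];
  first by rewrite !mul0.
  by rewrite !tens_mulDl IHx IHx'.
move: y; apply: tens_ind => [|y y' IHy IHy'|a' b'];
  first by rewrite !(mul0, mulx0).
  by rewrite mulDr !tens_mulDl mulDr IHy IHy'.
move: z; apply: tens_ind => [|z z' IHz IHz'|a2 b2];
  first by rewrite !mulx0.
  by rewrite !mulDr IHz IHz'.
by rewrite !tens_mul_pure !mulrA.
Qed.
Definition tens_one : T := pure ((1 : A) : alg_mod A) (1 : B).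
Fact tens_mul1 : left_id tens_one tens_mul.
Proof.
have mulx0 : right_zero 0 tens_mul by move=> x; rewrite tens_mulC mul0.
have mulDr : right_distributive tens_mul +%R.
  by move=> x y y'; rewrite !(tens_mulC x) tens_mulDl.
apply: tens_ind => [|x x' IHx IHx'|a b]; first exact: mulx0.
  by rewrite mulDr IHx IHx'.
by rewrite tens_mul_pure !mul1r.
Qed.

HB.instance Definition _ := GRing.Zmodule_isComPzRing.Build T
  tens_mulA tens_mulC tens_mul1 tens_mulDl.

Lemma tensM_pure (a a' : A) (b b' : B) :
  pure (a : alg_mod A) b * pure (a' : alg_mod A) b' =
  pure (a * a' : alg_mod A) (b * b') :> T.
Proof. exact: tens_mul_pure. Qed.

Lemma tens_scalerAl (c : B) (x y : T) : c *: (x * y) = (c *: x) * y.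
Proof.
move: x; apply: tens_ind => [|x x' IHx IHx'|a b];
  first by rewrite !(mul0r, scaler0).
  by rewrite mulrDl !scalerDr mulrDl IHx IHx'.
move: y; apply: tens_ind => [|y y' IHy IHy'|a' b'];
  first by rewrite !(mulr0, scaler0).
  by rewrite mulrDr !scalerDr mulrDr IHy IHy'.
by rewrite tensM_pure !tensZ_pure tensM_pure mulrA.
Qed.
End TensorAlgebra.

(** Functors on commutative k-algebras.  Their values are sets large enough to
    contain hom-sets between such functors, whereas k-algebras and k-modules
    are small; so the structures on the values are not the library's ones,
    whose carriers are the small types. *)

Record module_on (R : comPzRingType) (M : Type) := ModuleOn {
  mzero : M;
  madd : M -> M -> M;
  mopp : M -> M;
  mscale : R -> M -> M;
  maddA : associative madd;
  maddC : commutative madd;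
  madd0 : left_id mzero madd;
  maddN : left_inverse mzero mopp madd;
  mscaleA : forall a b x, mscale a (mscale b x) = mscale (a * b) x;
  mscale1 : left_id 1 mscale;
  mscaleDr : right_distributive mscale madd;
  mscaleDl : forall x a b, mscale (a + b) x = madd (mscale a x) (mscale b x)
}.

Definition lmod_on (R : comPzRingType) (V : lmodType R) : module_on R V :=
  @ModuleOn R V 0 +%R -%R *:%R (@addrA V) (@addrC V) (@add0r V) (@addNr V)
    (@scalerA R V) (@scale1r R V) (@scalerDr R V)
    (fun x a b => scalerDl x a b).

Record sfunctor (k : comPzRingType) := SFunctor {
  sf_ob :> calg k -> Type;
  sf_map : forall A B, calg_hom A B -> sf_ob A -> sf_ob B;
  sf_map_id : forall A x, sf_map (calg_id A) x = x;
  sf_map_comp : forall A B C (g : calg_hom B C) (f : calg_hom A B) x,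
    sf_map (calg_comp g f) x = sf_map g (sf_map f x)
}.

Record snat (k : comPzRingType) (F G : sfunctor k) := SNat {
  sn_fun :> forall B, F B -> G B;
  sn_nat : forall A B (f : calg_hom A B) x,
    sn_fun (sf_map f x) = sf_map f (sn_fun x)
}.

Definition siso (k : comPzRingType) (F G : sfunctor k) : Prop :=
  exists (u : snat F G) (v : snat G F),
    (forall B, cancel (u B) (v B)) /\ (forall B, cancel (v B) (u B)).

Record fmodule (k : comPzRingType) := FModule {
  fm_fun :> sfunctor k;
  fm_mod : forall B : calg k, module_on B (fm_fun B);
  fm_mapD : forall (A B : calg k) (f : calg_hom A B) (x y : fm_fun A),
    sf_map f (madd (fm_mod A) x y) =
    madd (fm_mod B) (sf_map f x) (sf_map f y);
  fm_mapZ : forall (A B : calg k) (f : calg_hom A B) (a : A) (x : fm_fun A),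
    sf_map f (mscale (fm_mod A) a x) = mscale (fm_mod B) (f a) (sf_map f x)
}.

Record alg_on (k : comPzRingType) (F : fmodule k) := AlgOn {
  amul : forall B : calg k, F B -> F B -> F B;
  aone : forall B : calg k, F B;
  amulA : forall B, associative (@amul B);
  amul1l : forall B, left_id (aone B) (@amul B);
  amul1r : forall B, right_id (aone B) (@amul B);
  amulDl : forall B, left_distributive (@amul B) (madd (fm_mod F B));
  amulDr : forall B, right_distributive (@amul B) (madd (fm_mod F B));
  amulZl : forall (B : calg k) (b : B) (x y : F B),
    amul (mscale (fm_mod F B) b x) y = mscale (fm_mod F B) b (amul x y);
  amulZr : forall (B : calg k) (b : B) (x y : F B),
    amul x (mscale (fm_mod F B) b y) = mscale (fm_mod F B) b (amul x y);
  amap_mul : forall A B (f : calg_hom A B) (x y : F A),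
    sf_map f (amul x y) = amul (sf_map f x) (sf_map f y);
  amap_one : forall A B (f : calg_hom A B), sf_map f (aone A) = aone B
}.

Definition alg_commutative (k : comPzRingType) (F : fmodule k)
  (s : alg_on F) : Prop := forall B, commutative (@amul _ _ s B).

Record falgebra (k : comPzRingType) := FAlgebra {
  fa_mod :> fmodule k;
  fa_alg : alg_on fa_mod
}.

Record falg_hom (k : comPzRingType) (F G : falgebra k) := FAlgHom {
  fah_nat :> snat F G;
  fah_add : forall (B : calg k) (x y : F B),
    fah_nat B (madd (fm_mod F B) x y) =
    madd (fm_mod G B) (fah_nat B x) (fah_nat B y);
  fah_scale : forall (B : calg k) (b : B) (x : F B),
    fah_nat B (mscale (fm_mod F B) b x) = mscale (fm_mod G B) b (fah_nat B x);
  fah_mul : forall (B : calg k) (x y : F B),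
    fah_nat B (amul (fa_alg F) x y) =
    amul (fa_alg G) (fah_nat B x) (fah_nat B y);
  fah_one : forall B : calg k, fah_nat B (aone (fa_alg F) B) = aone (fa_alg G) B
}.

Lemma snat_eq (k : comPzRingType) (F G : sfunctor k) (u v : snat F G) :
  (forall B x, u B x = v B x) -> u = v.
Proof.
case: u v => [u un] [v vn] /= uv.
have e : u = v by apply: functional_extensionality_dep => B; apply: funext.
by subst v; rewrite (Prop_irrelevance un vn).
Qed.

Lemma falg_hom_eq (k : comPzRingType) (F G : falgebra k) (u v : falg_hom F G) :
  (forall B x, u B x = v B x) -> u = v.
Proof.
case: u v => [u u1 u2 u3 u4] [v v1 v2 v3 v4] /= /snat_eq uv; subst v.
by rewrite (Prop_irrelevance u1 v1) (Prop_irrelevance u2 v2)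
  (Prop_irrelevance u3 v3) (Prop_irrelevance u4 v4).
Qed.

Definition falg_hom_comp (k : comPzRingType) (F G H : falgebra k)
  (v : falg_hom G H) (u : falg_hom F G) : falg_hom F H.
Proof.
unshelve refine (@FAlgHom k F H (@SNat k F H (fun B x => v B (u B x)) _)
  _ _ _ _).
- by move=> A B f x; rewrite !sn_nat.
- by move=> B x y /=; rewrite !fah_add.
- by move=> B b x /=; rewrite !fah_scale.
- by move=> B x y /=; rewrite !fah_mul.
- by move=> B /=; rewrite !fah_one.
Defined.

(** The quasi-coherent functor B |-> E (x)_k B. *)

Definition qc_fun (k : comPzRingType) (E : lmodType k) : sfunctor k.
Proof.
unshelve refine (@SFunctor k (fun B => tensor E B)
  (fun A B f => tens_map (@idfun E) f) _ _).
- move=> A x; move: x; apply: tens_ind => [|x y IHx IHy|e b].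
  + by rewrite tens_map0.
  + by rewrite tens_mapD IHx IHy.
  + by rewrite tens_map_pure.
- move=> A B C g f x; move: x; apply: tens_ind => [|x y IHx IHy|e b].
  + by rewrite !tens_map0.
  + by rewrite !tens_mapD IHx IHy.
  + by rewrite !tens_map_pure.
Defined.

Definition qc (k : comPzRingType) (E : lmodType k) : fmodule k :=
  @FModule k (qc_fun E) (fun B => lmod_on (tensor E B))
    (fun A B f => tens_mapD _ f) (fun A B f => tens_mapZ _ f).

Definition qc_alg_on (k : comPzRingType) (A : calg k) :
  alg_on (qc (alg_mod A)).
Proof.
unshelve refine (@AlgOn k (qc (alg_mod A))
  (fun B x y => (x : tensor (alg_mod A) B) * y)
  (fun B => (1 : tensor (alg_mod A) B)) _ _ _ _ _ _ _ _ _).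
- by move=> B; apply: mulrA.
- by move=> B; apply: mul1r.
- by move=> B; apply: mulr1.
- by move=> B; apply: mulrDl.
- by move=> B; apply: mulrDr.
- by move=> B b x y; rewrite [LHS]/= -tens_scalerAl.
- by move=> B b x y; rewrite [LHS]mulrC [LHS]/= -tens_scalerAl mulrC.
- move=> B C f x y; rewrite /=.
  move: x; apply: tens_ind => [|x x' IHx IHx'|a b].
  + by rewrite !(mul0r, tens_map0).
  + by rewrite mulrDl !tens_mapD mulrDl IHx IHx'.
  move: y; apply: tens_ind => [|y y' IHy IHy'|a' b'].
  + by rewrite !(mulr0, tens_map0).
  + by rewrite mulrDr !tens_mapD mulrDr IHy IHy'.
  by rewrite tensM_pure !tens_map_pure tensM_pure rmorphM.
- by move=> B C f; rewrite [LHS]tens_map_pure rmorph1.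
Defined.

Definition qc_alg (k : comPzRingType) (A : calg k) : falgebra k :=
  FAlgebra (qc_alg_on A).

Section AlgHomLinear.
Variables (k : comPzRingType) (A B : calg k) (f : calg_hom A B).
Definition alg_mod_map (a : alg_mod A) : alg_mod B := f a.
Fact alg_mod_map_linear : linear alg_mod_map.
Proof.
by move=> r u v; rewrite /alg_mod_map rmorphD !alg_scaleE rmorphM calg_funE.
Qed.
HB.instance Definition _ := GRing.isLinear.Build k (alg_mod A) (alg_mod B) _
  alg_mod_map alg_mod_map_linear.
End AlgHomLinear.

Definition qc_alg_map (k : comPzRingType) (A B : calg k) (f : calg_hom A B) :
  falg_hom (qc_alg A) (qc_alg B).
Proof.
unshelve refine (@FAlgHom k (qc_alg A) (qc_alg B)
  (@SNat k (qc_alg A) (qc_alg B)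
     (fun S => tens_map (alg_mod_map f) (calg_id S)) _) _ _ _ _).
- move=> S T g x; rewrite /=.
  move: x; apply: tens_ind => [|x y IHx IHy|a b].
  + by rewrite !tens_map0.
  + by rewrite !tens_mapD IHx IHy.
  + by rewrite !tens_map_pure.
- by move=> S x y; apply: tens_mapD.
- by move=> S s x; apply: tens_mapZ.
- move=> S x y; rewrite /=.
  move: x; apply: tens_ind => [|x x' IHx IHx'|a b].
  + by rewrite !(mul0r, tens_map0).
  + by rewrite mulrDl !tens_mapD mulrDl IHx IHx'.
  move: y; apply: tens_ind => [|y y' IHy IHy'|a' b'].
  + by rewrite !(mulr0, tens_map0).
  + by rewrite mulrDr !tens_mapD mulrDr IHy IHy'.
  by rewrite tensM_pure !tens_map_pure tensM_pure; congr pure; apply: rmorphM.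
- by move=> S; rewrite [LHS]tens_map_pure; congr pure; apply: rmorph1.
Defined.

Definition Spec (k : comPzRingType) (F : falgebra k) : sfunctor k.
Proof.
unshelve refine (@SFunctor k (fun B => falg_hom F (qc_alg B))
  (fun A B f u => falg_hom_comp (qc_alg_map f) u) _ _).
- move=> A u; apply: falg_hom_eq => S x /=.
  move: (u S x); apply: tens_ind => [|y z IHy IHz|a b].
  + by rewrite tens_map0.
  + by rewrite tens_mapD IHy IHz.
  + by rewrite tens_map_pure.
- move=> A B C g f u; apply: falg_hom_eq => S x /=.
  move: (u S x); apply: tens_ind => [|y z IHy IHz|a b].
  + by rewrite !tens_map0.
  + by rewrite !tens_mapD IHy IHz.
  + by rewrite !tens_map_pure.
Defined.

(** Internal homs.  A commutative B-algebra is a k-algebra S with a morphism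
    s : B -> S of k-algebras, and a morphism of B-algebras (S, s) -> (T, t) is
    a morphism g : S -> T with t = g o s; so a morphism between the restrictions
    of two functors to B-algebras is a family indexed by such pairs (S, s). *)

Record fmod_hom_at (k : comPzRingType) (F H : fmodule k) (B : calg k) :=
FModHomAt {
  fmh_fun :> forall S : calg k, calg_hom B S -> F S -> H S;
  fmh_nat : forall (S T : calg k) (s : calg_hom B S) (g : calg_hom S T) x,
    fmh_fun (calg_comp g s) (sf_map g x) = sf_map g (fmh_fun s x);
  fmh_add : forall (S : calg k) (s : calg_hom B S) (x y : F S),
    fmh_fun s (madd (fm_mod F S) x y) =
    madd (fm_mod H S) (fmh_fun s x) (fmh_fun s y);
  fmh_scale : forall (S : calg k) (s : calg_hom B S) (a : S) (x : F S),
    fmh_fun s (mscale (fm_mod F S) a x) = mscale (fm_mod H S) a (fmh_fun s x)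
}.

Lemma fmod_hom_at_eq (k : comPzRingType) (F H : fmodule k) (B : calg k)
  (u v : fmod_hom_at F H B) :
  (forall S (s : calg_hom B S) x, u S s x = v S s x) -> u = v.
Proof.
case: u v => [u u1 u2 u3] [v v1 v2 v3] /= uv.
have e : u = v.
  by do 3![apply: functional_extensionality_dep => ?].
subst v; rewrite (Prop_irrelevance u1 v1) (Prop_irrelevance u2 v2).
by rewrite (Prop_irrelevance u3 v3).
Qed.

Lemma maddACA (R : comPzRingType) (M : Type) (m : module_on R M) a b c d :
  madd m (madd m a b) (madd m c d) = madd m (madd m a c) (madd m b d).
Proof.
by rewrite -!(maddA m); congr madd; rewrite !(maddA m) (maddC m b c).
Qed.

Lemma mscaleCA (R : comPzRingType) (M : Type) (m : module_on R M) a b x :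
  mscale m a (mscale m b x) = mscale m b (mscale m a x).
Proof. by rewrite !mscaleA mulrC. Qed.

Lemma madd_cancel (R : comPzRingType) (M : Type) (m : module_on R M) x y z :
  madd m x y = madd m x z -> y = z.
Proof.
move=> e; rewrite -[y](madd0 m) -[z](madd0 m) -(maddN m x).
by rewrite -!(maddA m) e.
Qed.

Lemma mscale0 (R : comPzRingType) (M : Type) (m : module_on R M) a :
  mscale m a (mzero m) = mzero m.
Proof.
apply: (@madd_cancel _ _ m (mscale m a (mzero m))).
by rewrite -mscaleDr (maddC m _ (mzero m)) !madd0.
Qed.

Lemma mscale0l (R : comPzRingType) (M : Type) (m : module_on R M) x :
  mscale m 0 x = mzero m.
Proof.
apply: (@madd_cancel _ _ m (mscale m 0 x)).
by rewrite -mscaleDl addr0 (maddC m _ (mzero m)) madd0.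
Qed.

Lemma moppE (R : comPzRingType) (M : Type) (m : module_on R M) x :
  mopp m x = mscale m (-1) x.
Proof.
apply: (@madd_cancel _ _ m x); rewrite (maddC m) maddN.
by rewrite -{1}(mscale1 m x) -mscaleDl subrr mscale0l.
Qed.

Section InternalHom.
Variables (k : comPzRingType) (F H : fmodule k).

Section At.
Variable B : calg k.

Definition fhom_zero : fmod_hom_at F H B.
Proof.
unshelve refine (@FModHomAt k F H B (fun S _ _ => mzero (fm_mod H S)) _ _ _).
- move=> S T s g x.
  rewrite -[in RHS](@mscale0l _ _ (fm_mod H S) (mzero (fm_mod H S))).
  by rewrite fm_mapZ rmorph0 mscale0l.
- by move=> S s x y /=; rewrite madd0.
- by move=> S s a x /=; rewrite mscale0.
Defined.

Definition fhom_add (u v : fmod_hom_at F H B) : fmod_hom_at F H B.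
Proof.
unshelve refine (@FModHomAt k F H B
  (fun S s x => madd (fm_mod H S) (u S s x) (v S s x)) _ _ _).
- by move=> S T s g x; rewrite !fmh_nat fm_mapD.
- by move=> S s x y /=; rewrite !fmh_add maddACA.
- by move=> S s a x /=; rewrite !fmh_scale mscaleDr.
Defined.

Definition fhom_scale (b : B) (u : fmod_hom_at F H B) : fmod_hom_at F H B.
Proof.
unshelve refine (@FModHomAt k F H B
  (fun S s x => mscale (fm_mod H S) (s b) (u S s x)) _ _ _).
- by move=> S T s g x; rewrite !fmh_nat fm_mapZ.
- by move=> S s x y /=; rewrite fmh_add mscaleDr.
- by move=> S s a x /=; rewrite fmh_scale mscaleCA.
Defined.

Definition fhom_mod : module_on B (fmod_hom_at F H B).
Proof.
unshelve refine (@ModuleOn B _ fhom_zero fhom_add (fhom_scale (-1)) fhom_scale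
  _ _ _ _ _ _ _ _).
- by move=> u v w; apply: fmod_hom_at_eq => S s x /=; rewrite maddA.
- by move=> u v; apply: fmod_hom_at_eq => S s x /=; rewrite maddC.
- by move=> u; apply: fmod_hom_at_eq => S s x /=; rewrite madd0.
- move=> u; apply: fmod_hom_at_eq => S s x /=.
  by rewrite rmorphN rmorph1 -moppE maddN.
- by move=> a b u; apply: fmod_hom_at_eq => S s x /=; rewrite mscaleA rmorphM.
- by move=> u; apply: fmod_hom_at_eq => S s x /=; rewrite rmorph1 mscale1.
- by move=> a u v; apply: fmod_hom_at_eq => S s x /=; rewrite mscaleDr.
- by move=> u a b; apply: fmod_hom_at_eq => S s x /=; rewrite rmorphD mscaleDl.
Defined.
End At.

Definition fhom_map (A B : calg k) (f : calg_hom A B)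
  (u : fmod_hom_at F H A) : fmod_hom_at F H B.
Proof.
unshelve refine (@FModHomAt k F H B (fun S s x => u S (calg_comp s f) x) _ _ _).
- by move=> S T s g x; rewrite -calg_compA fmh_nat.
- by move=> S s x y /=; rewrite fmh_add.
- by move=> S s a x /=; rewrite fmh_scale.
Defined.

Definition fhom_fun : sfunctor k.
Proof.
unshelve refine (@SFunctor k (fmod_hom_at F H) fhom_map _ _).
- by move=> A u; apply: fmod_hom_at_eq => S s x /=; rewrite calg_compf1.
- move=> A B C g f u; apply: fmod_hom_at_eq => S s x /=.
  by rewrite calg_compA.
Defined.

Definition fhom : fmodule k.
Proof.
unshelve refine (@FModule k fhom_fun fhom_mod _ _).
- by move=> A B f u v; apply: fmod_hom_at_eq.
- by move=> A B f a u; apply: fmod_hom_at_eq.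
Defined.
End InternalHom.

(** The functor B |-> B. *)

Definition base_fun (k : comPzRingType) : sfunctor k :=
  @SFunctor k (fun B => B) (fun A B f => f) (fun _ _ => erefl)
    (fun _ _ _ _ _ _ => erefl).

Definition base (k : comPzRingType) : fmodule k.
Proof.
unshelve refine (@FModule k (base_fun k) (fun B => lmod_on (B : comPzRingType)^o)
  _ _).
- by move=> A B f x y; apply: rmorphD.
- by move=> A B f a x; apply: rmorphM.
Defined.

Definition fdual (k : comPzRingType) (F : fmodule k) : fmodule k :=
  fhom F (base k).

(** Functors of monoids. *)

Record monoid_on (M : Type) := MonoidOn {
  gmul : M -> M -> M;
  gone : M;
  gmulA : associative gmul;
  gmul1l : left_id gone gmul;
  gmul1r : right_id gone gmul
}.

Record fmonoid (k : comPzRingType) := FMonoid {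
  fg_fun :> sfunctor k;
  fg_mon : forall B : calg k, monoid_on (fg_fun B);
  fg_mapM : forall (A B : calg k) (f : calg_hom A B) (x y : fg_fun A),
    sf_map f (gmul (fg_mon A) x y) =
    gmul (fg_mon B) (sf_map f x) (sf_map f y);
  fg_map1 : forall (A B : calg k) (f : calg_hom A B),
    sf_map f (gone (fg_mon A)) = gone (fg_mon B)
}.

Definition abelian (k : comPzRingType) (H : fmonoid k) : Prop :=
  forall B, commutative (gmul (fg_mon H B)).

Record fmon_hom (k : comPzRingType) (G H : fmonoid k) := FMonHom {
  fgh_nat :> snat G H;
  fgh_mul : forall (B : calg k) (x y : G B),
    fgh_nat B (gmul (fg_mon G B) x y) =
    gmul (fg_mon H B) (fgh_nat B x) (fgh_nat B y);
  fgh_one : forall B : calg k, fgh_nat B (gone (fg_mon G B)) = gone (fg_mon H B)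
}.

Lemma fmon_hom_eq (k : comPzRingType) (G H : fmonoid k) (u v : fmon_hom G H) :
  (forall B x, u B x = v B x) -> u = v.
Proof.
case: u v => [u u1 u2] [v v1 v2] /= /snat_eq uv; subst v.
by rewrite (Prop_irrelevance u1 v1) (Prop_irrelevance u2 v2).
Qed.

Definition fmon_id (k : comPzRingType) (G : fmonoid k) : fmon_hom G G :=
  @FMonHom k G G (@SNat k G G (fun B x => x) (fun _ _ _ _ => erefl))
    (fun _ _ _ => erefl) (fun _ => erefl).

Definition fmon_comp (k : comPzRingType) (F G H : fmonoid k)
  (v : fmon_hom G H) (u : fmon_hom F G) : fmon_hom F H.
Proof.
unshelve refine (@FMonHom k F H (@SNat k F H (fun B x => v B (u B x)) _) _ _).
- by move=> A B f x; rewrite !sn_nat.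
- by move=> B x y /=; rewrite !fgh_mul.
- by move=> B /=; rewrite !fgh_one.
Defined.

Definition base_mon (k : comPzRingType) : fmonoid k :=
  @FMonoid k (base_fun k)
    (fun B => @MonoidOn B *%R 1 (@mulrA B) (@mul1r B) (@mulr1 B))
    (fun A B f => rmorphM f) (fun A B f => rmorph1 f).

Record fmon_hom_at (k : comPzRingType) (G H : fmonoid k) (B : calg k) :=
FMonHomAt {
  fga_fun :> forall S : calg k, calg_hom B S -> G S -> H S;
  fga_nat : forall (S T : calg k) (s : calg_hom B S) (g : calg_hom S T) x,
    fga_fun (calg_comp g s) (sf_map g x) = sf_map g (fga_fun s x);
  fga_mul : forall (S : calg k) (s : calg_hom B S) (x y : G S),
    fga_fun s (gmul (fg_mon G S) x y) =
    gmul (fg_mon H S) (fga_fun s x) (fga_fun s y);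
  fga_one : forall (S : calg k) (s : calg_hom B S),
    fga_fun s (gone (fg_mon G S)) = gone (fg_mon H S)
}.

Lemma fmon_hom_at_eq (k : comPzRingType) (G H : fmonoid k) (B : calg k)
  (u v : fmon_hom_at G H B) :
  (forall S (s : calg_hom B S) x, u S s x = v S s x) -> u = v.
Proof.
case: u v => [u u1 u2 u3] [v v1 v2 v3] /= uv.
have e : u = v.
  by do 3![apply: functional_extensionality_dep => ?].
subst v; rewrite (Prop_irrelevance u1 v1) (Prop_irrelevance u2 v2).
by rewrite (Prop_irrelevance u3 v3).
Qed.

Section DualMonoid.
Variables (k : comPzRingType) (H : fmonoid k).
Local Notation hom_at := (fmon_hom_at H (base_mon k)).

Definition mdual_mul (B : calg k) (u v : hom_at B) : hom_at B.
Proof.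
unshelve refine (@FMonHomAt k H (base_mon k) B
  (fun S s x => ((u S s x : S) * (v S s x : S) : S)) _ _ _).
- by move=> S T s g x; rewrite !fga_nat /= rmorphM.
- by move=> S s x y; rewrite !fga_mul /= mulrACA.
- by move=> S s; rewrite !fga_one /= mulr1.
Defined.

Definition mdual_one (B : calg k) : hom_at B.
Proof.
unshelve refine (@FMonHomAt k H (base_mon k) B (fun S s x => (1 : S)) _ _ _).
- by move=> S T s g x; rewrite /= rmorph1.
- by move=> S s x y; rewrite /= mulr1.
- by [].
Defined.

Definition mdual_mon (B : calg k) : monoid_on (hom_at B).
Proof.
unshelve refine (@MonoidOn _ (@mdual_mul B) (mdual_one B) _ _ _).
- by move=> u v w; apply: fmon_hom_at_eq => S s x /=; rewrite mulrA.
- by move=> u; apply: fmon_hom_at_eq => S s x /=; rewrite mul1r.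
- by move=> u; apply: fmon_hom_at_eq => S s x /=; rewrite mulr1.
Defined.

Definition mdual_map (A B : calg k) (f : calg_hom A B) (u : hom_at A) :
  hom_at B.
Proof.
unshelve refine (@FMonHomAt k H (base_mon k) B
  (fun S s x => u S (calg_comp s f) x) _ _ _).
- by move=> S T s g x; rewrite -calg_compA fga_nat.
- by move=> S s x y /=; rewrite fga_mul.
- by move=> S s /=; rewrite fga_one.
Defined.

Definition mdual_fun : sfunctor k.
Proof.
unshelve refine (@SFunctor k hom_at mdual_map _ _).
- by move=> A u; apply: fmon_hom_at_eq => S s x /=; rewrite calg_compf1.
- move=> A B C g f u; apply: fmon_hom_at_eq => S s x /=.
  by rewrite calg_compA.
Defined.

Definition mdual : fmonoid k.
Proof.
unshelve refine (@FMonoid k mdual_fun mdual_mon _ _).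
- by move=> A B f u v; apply: fmon_hom_at_eq.
- by move=> A B f; apply: fmon_hom_at_eq.
Defined.
End DualMonoid.

Definition mdual_hom (k : comPzRingType) (G H : fmonoid k) (u : fmon_hom G H) :
  fmon_hom (mdual H) (mdual G).
Proof.
unshelve refine (@FMonHom k (mdual H) (mdual G)
  (@SNat k (mdual H) (mdual G) (fun B (w : fmon_hom_at H (base_mon k) B) =>
     @FMonHomAt k G (base_mon k) B (fun S s x => w S s (u S x)) _ _ _) _) _ _).
- by move=> S T s g x; rewrite sn_nat fga_nat.
- by move=> S s x y; rewrite fgh_mul fga_mul.
- by move=> S s; rewrite fgh_one fga_one.
- by move=> A B f w; apply: fmon_hom_at_eq.
- by move=> B w w'; apply: fmon_hom_at_eq.
- by move=> B; apply: fmon_hom_at_eq.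
Defined.

(** Categories. *)

Record category := Category {
  ob :> Type;
  hom : ob -> ob -> Type;
  idm : forall x, hom x x;
  compm : forall x y z, hom y z -> hom x y -> hom x z;
  compmA : forall x y z t (h : hom z t) (g : hom y z) (f : hom x y),
    compm h (compm g f) = compm (compm h g) f;
  comp1m : forall x y (f : hom x y), compm (idm y) f = f;
  compm1 : forall x y (f : hom x y), compm f (idm x) = f
}.
Arguments hom {c}.
Arguments idm {c}.
Arguments compm {c x y z}.

Definition full_subcategory (C : category) (P : C -> Prop) : category :=
  @Category {x : C | P x} (fun x y => hom (sval x) (sval y))
    (fun x => idm (sval x)) (fun x y z g f => compm g f)
    (fun _ _ _ _ _ _ _ => compmA _ _ _)
    (fun _ _ _ => comp1m _) (fun _ _ _ => compm1 _).

Record functor (C D : category) := Functor {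
  fun_ob :> C -> D;
  fun_hom : forall x y, hom x y -> hom (fun_ob x) (fun_ob y);
  fun_id : forall x, fun_hom (idm x) = idm (fun_ob x);
  fun_comp : forall x y z (g : hom y z) (f : hom x y),
    fun_hom (compm g f) = compm (fun_hom g) (fun_hom f)
}.

Record contrafunctor (C D : category) := ContraFunctor {
  cof_ob :> C -> D;
  cof_hom : forall x y, hom x y -> hom (cof_ob y) (cof_ob x);
  cof_id : forall x, cof_hom (idm x) = idm (cof_ob x);
  cof_comp : forall x y z (g : hom y z) (f : hom x y),
    cof_hom (compm g f) = compm (cof_hom f) (cof_hom g)
}.

Definition id_functor (C : category) : functor C C :=
  @Functor C C id (fun _ _ f => f) (fun _ => erefl) (fun _ _ _ _ _ => erefl).

Definition contra_comp (C D E : category) (G : contrafunctor D E)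
  (F : contrafunctor C D) : functor C E.
Proof.
unshelve refine (@Functor C E (fun x => G (F x))
  (fun x y f => cof_hom G (cof_hom F f)) _ _).
- by move=> x; rewrite !cof_id.
- by move=> x y z g f; rewrite !cof_comp.
Defined.

Definition isomorphism (C : category) (x y : C) (f : hom x y) : Prop :=
  exists g : hom y x, compm g f = idm x /\ compm f g = idm y.

Definition naturally_isomorphic (C D : category) (F G : functor C D) : Prop :=
  exists eta : forall x, hom (F x) (G x),
    (forall x y (f : hom x y),
       compm (eta y) (fun_hom F f) = compm (fun_hom G f) (eta x)) /\
    (forall x, isomorphism (eta x)).

Definition anti_equivalence (C D : category) (F : contrafunctor C D)
  (G : contrafunctor D C) : Prop :=
  naturally_isomorphic (id_functor C) (contra_comp G F) /\
  naturally_isomorphic (id_functor D) (contra_comp F G).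

Definition contra_restrict (C D : category) (F : contrafunctor C D)
  (P : C -> Prop) (Q : D -> Prop) (PQ : forall x, P x -> Q (F x)) :
  contrafunctor (full_subcategory P) (full_subcategory Q) :=
  @ContraFunctor (full_subcategory P) (full_subcategory Q)
    (fun x => exist Q (F (sval x)) (PQ (sval x) (svalP x)))
    (fun x y f => cof_hom F f)
    (fun x => cof_id F (sval x)) (fun x y z g f => cof_comp F g f).

Definition FMon (k : comPzRingType) : category.
Proof.
unshelve refine (@Category (fmonoid k) (@fmon_hom k) (@fmon_id k)
  (@fmon_comp k) _ _ _).
- by move=> F G H K w v u; apply: fmon_hom_eq.
- by move=> F G u; apply: fmon_hom_eq.
- by move=> F G u; apply: fmon_hom_eq.
Defined.

Definition mdual_functor (k : comPzRingType) : contrafunctor (FMon k) (FMon k).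
Proof.
unshelve refine (@ContraFunctor (FMon k) (FMon k) (@mdual k) (@mdual_hom k) _ _).
- by move=> G; apply: fmon_hom_eq => B w; apply: fmon_hom_at_eq.
- by move=> F G H v u; apply: fmon_hom_eq => B w; apply: fmon_hom_at_eq.
Defined.

(* "Of the form Spec" is read up to isomorphism of functors of sets. *)
Definition affine_monoid (k : comPzRingType) (G : FMon k) : Prop :=
  abelian G /\
  exists A : calg k, projective (alg_mod A) /\ siso G (Spec (qc_alg A)).

Definition alg_scheme_monoid (k : comPzRingType) (H : FMon k) : Prop :=
  abelian H /\
  exists (C : lmodType k) (s : alg_on (fdual (qc C))),
    [/\ projective C, alg_commutative s & siso H (Spec (FAlgebra s))].

(* Main.v *)
(* Let F be a functor of commutative algebras that is reflexive as a module and
   such that F(B) is the set of all functions on X|B, where X = Spec F.  If X is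
   an abelian monoid, then F^* is a commutative algebra under the convolution
   (p * q)(f) = p(x |-> q(y |-> f(xy))), and a function f on X is a character
   exactly when p |-> p(f) is multiplicative on F^*; as F = F^**, this says
   X^* = Spec F^*.  If moreover F^* consists of all the functions on X^*, then a
   character of X^* is an element p of F^*, multiplicativity of p on F may be
   tested on characters, and so p is a point of X: X = X^**.

   Both F = A and F = C^* satisfy the hypotheses.  Reflexivity of E (x) - is seen
   at the functional e |-> (0, e) with values in a square-zero extension.  The
   functions on Spec A are A by Yoneda.  For C^*, a finite list Y of elements of
   C gives the quotient R_Y of C^*(B) by the ideal generated by the functionals
   vanishing on Y; a dual basis (f_j, c_j) covering Y makes sum_j c_j (x) [f_j]
   a point of Spec C^* with values in R_Y, universal among the points supported
   on Y.  A function on Spec C^* thus yields compatible elements of the rings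
   R_Y.  Since the comultiple of c in C involves finitely many elements, c is
   well defined on R_Y for Y large, and these elements glue to one of C^*(B). *)

From HB Require Import structures.
Require Import Defs.
From mathcomp Require Import all_boot all_algebra.
From mathcomp Require Import boolp functions.

Set Implicit Arguments.
Unset Strict Implicit.
Unset Printing Implicit Defensive.

Import GRing.Theory.
Local Open Scope ring_scope.
Local Open Scope quotient_scope.

(** * Functors of points, duals and evaluation *)

Lemma sig_bij (T U : Type) (f : T -> U) :
  injective f -> (forall y, exists x, f x = y) ->
  exists g, cancel f g /\ cancel g f.
Proof.
move=> fI fS; pose g y := sval (cid (fS y)).
have gK : cancel g f by move=> y; apply: (svalP (cid (fS y))).
by exists g; split=> // x; apply: fI; rewrite gK.
Qed.

Section FunctorIso.
Variable k : comPzRingType.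

Lemma snat_inverse (X Y : sfunctor k) (u : snat X Y) :
  (forall B, injective (u B)) -> (forall B y, exists x, u B x = y) ->
  exists v : snat Y X, (forall B, cancel (u B) (v B)) /\
    (forall B, cancel (v B) (u B)).
Proof.
move=> uI uS; pose v B := sval (cid (sig_bij (uI B) (uS B))).
have vP B : cancel (u B) (v B) /\ cancel (v B) (u B).
  exact: (svalP (cid (sig_bij (uI B) (uS B)))).
have vN A B (f : calg_hom A B) x : v B (sf_map f x) = sf_map f (v A x).
  by apply: (uI B); rewrite (proj2 (vP B)) sn_nat (proj2 (vP A)).
by exists (SNat vN); split=> B; case: (vP B).
Qed.

Lemma siso_bij (X Y : sfunctor k) (u : snat X Y) :
  (forall B, injective (u B)) -> (forall B y, exists x, u B x = y) -> siso X Y.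
Proof. by move=> uI uS; case: (snat_inverse uI uS) => v; exists u, v. Qed.

Lemma siso_trans (X Y Z : sfunctor k) : siso X Y -> siso Y Z -> siso X Z.
Proof.
move=> [u [u' [uK u'K]]] [v [v' [vK v'K]]].
have wN A B (f : calg_hom A B) x : v B (u B (sf_map f x)) = sf_map f (v A (u A x)).
  by rewrite !sn_nat.
apply: (@siso_bij _ _ (SNat wN)) => B /=.
  exact: inj_comp (can_inj (vK B)) (can_inj (uK B)).
by move=> z; exists (u' B (v' B z)); rewrite u'K v'K.
Qed.

Lemma siso_sym (X Y : sfunctor k) : siso X Y -> siso Y X.
Proof. by move=> [u [v [uK vK]]]; exists v, u. Qed.
End FunctorIso.

Section Dual.
Variables (k : comPzRingType) (F : fmodule k).

(** Only the component at the identity is kept. By [fmhE] the component at [s] is this one for the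
    base change [sf_map s p], so functionals can be handled through [app] and [sf_map] alone. *)
Definition app (B : calg k) (p : fdual F B) (f : F B) : B :=
  fmh_fun p (calg_id B) f.

Lemma fmhE (B S : calg k) (p : fdual F B) (s : calg_hom B S) (f : F S) :
  fmh_fun p s f = app (sf_map s p) f :> S.
Proof. by rewrite /app /= calg_comp1f. Qed.

Lemma app_nat (B S : calg k) (s : calg_hom B S) (p : fdual F B) (f : F B) :
  app (sf_map s p) (sf_map s f) = s (app p f).
Proof. by rewrite -fmhE; have := fmh_nat p (calg_id B) s f; rewrite calg_compf1. Qed.

Section Value.
Variables (B : calg k) (p : fdual F B).

Lemma appD (f g : F B) : app p (madd (fm_mod F B) f g) = app p f + app p g.
Proof. exact: (fmh_add p). Qed.

Lemma appZ (b : B) (f : F B) : app p (mscale (fm_mod F B) b f) = b * app p f.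
Proof. exact: (fmh_scale p). Qed.

Lemma app0 : app p (mzero (fm_mod F B)) = 0.
Proof. by rewrite -(@mscale0l _ _ (fm_mod F B) (mzero (fm_mod F B))) appZ mul0r. Qed.

Lemma app_addl (q : fdual F B) (f : F B) :
  app (madd (fm_mod (fdual F) B) p q) f = app p f + app q f.
Proof. by []. Qed.

Lemma app_scalel (b : B) (f : F B) :
  app (mscale (fm_mod (fdual F) B) b p) f = b * app p f.
Proof. by []. Qed.
End Value.

Lemma dual_eq (B : calg k) (p q : fdual F B) :
  (forall (S : calg k) (s : calg_hom B S) (f : F S),
     app (sf_map s p) f = app (sf_map s q) f) -> p = q.
Proof. move=> pq; apply: fmod_hom_at_eq => S s x; rewrite (fmhE p) (fmhE q); exact: pq. Qed.
End Dual.

Section Affine.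
Variable k : comPzRingType.

(** These are the functions on [X] over [B]: morphisms of functors of sets from the restriction of
    [X] to B-algebras to the affine line. *)
Record fun_at (X : sfunctor k) (B : calg k) := FunAt {
  fa_fun :> forall S : calg k, calg_hom B S -> X S -> S;
  fa_nat : forall (S T : calg k) (s : calg_hom B S) (g : calg_hom S T) (x : X S),
    fa_fun (calg_comp g s) (sf_map g x) = g (fa_fun s x)
}.

(** A second model for the points of the spectrum: a functional over [B] that is multiplicative
    after every base change, in place of a morphism to [qc_alg B]. Points then lie inside [fdual F];
    [spec_fspec] compares the two models. *)
Record spec_at (F : falgebra k) (B : calg k) := SpecAt {
  sp_lin :> fdual F B;
  sp_mul : forall (S : calg k) (s : calg_hom B S) (f g : F S),
    app (sf_map s sp_lin) (amul (fa_alg F) f g) =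
    app (sf_map s sp_lin) f * app (sf_map s sp_lin) g;
  sp_one : forall (S : calg k) (s : calg_hom B S),
    app (sf_map s sp_lin) (aone (fa_alg F) S) = 1
}.

Section FSpec.
Variable F : falgebra k.

Lemma spec_at_eq (B : calg k) (h h' : spec_at F B) :
  sp_lin h = sp_lin h' -> h = h'.
Proof.
case: h h' => [h hM h1] [h' h'M h'1] /= e; subst h'.
by rewrite (Prop_irrelevance hM h'M) (Prop_irrelevance h1 h'1).
Qed.

Definition spec_map (A B : calg k) (f : calg_hom A B) (h : spec_at F A) :
  spec_at F B.
Proof.
exists (sf_map f (sp_lin h)) => S s.
- by move=> x y; rewrite -!sf_map_comp sp_mul.
- by rewrite -!sf_map_comp sp_one.
Defined.

Definition fspec : sfunctor k.
Proof.
exists (spec_at F) spec_map.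
- by move=> A h; apply: spec_at_eq; apply: (sf_map_id (s := fdual F)).
- by move=> A B C g f h; apply: spec_at_eq; apply: (sf_map_comp (s := fdual F)).
Defined.

Lemma specM (B : calg k) (h : fspec B) (f g : F B) :
  app (sp_lin h) (amul (fa_alg F) f g) = app (sp_lin h) f * app (sp_lin h) g.
Proof.
by have := sp_mul h (calg_id B) f g; rewrite (sf_map_id (s := fdual F)).
Qed.

Lemma spec1 (B : calg k) (h : fspec B) : app (sp_lin h) (aone (fa_alg F) B) = 1.
Proof.
by have := sp_one h (calg_id B); rewrite (sf_map_id (s := fdual F)).
Qed.
End FSpec.

(** The two clauses are surjectivity and injectivity of the map from F(B) to the functions on the
    spectrum over [B]. *)
Definition faffine (F : falgebra k) : Prop := forall B : calg k,
  (forall P : fun_at (fspec F) B, exists f : F B,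
     forall (S : calg k) (s : calg_hom B S) (h : fspec F S),
       P S s h = app (sp_lin h) (sf_map s f)) /\
  (forall f f' : F B,
     (forall (S : calg k) (s : calg_hom B S) (h : fspec F S),
       app (sp_lin h) (sf_map s f) = app (sp_lin h) (sf_map s f')) -> f = f').

(** Bijectivity of F -> F^** over every [B], split into surjectivity and injectivity as above. *)
Definition freflexive (F : fmodule k) : Prop := forall B : calg k,
  (forall P : fdual (fdual F) B, exists f : F B,
     forall (S : calg k) (s : calg_hom B S) (p : fdual F S),
       app (sf_map s P) p = app p (sf_map s f)) /\
  (forall f f' : F B,
     (forall (S : calg k) (s : calg_hom B S) (p : fdual F S),
       app p (sf_map s f) = app p (sf_map s f')) -> f = f').

Definition eval_dual (F : fmodule k) (B : calg k) (f : F B) :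
  fdual (fdual F) B.
Proof.
unshelve refine (@FModHomAt k (fdual F) (base k) B
  (fun S s p => app p (sf_map s f)) _ _ _) => //.
by move=> S T s g p; rewrite sf_map_comp app_nat.
Defined.

Lemma app_eval_dual (F : fmodule k) (B : calg k) (f : F B) (p : fdual F B) :
  app (eval_dual f) p = app p f.
Proof. by rewrite {1}/app /= sf_map_id. Qed.

Lemma eval_dual_map (F : fmodule k) (A B : calg k) (g : calg_hom A B) (f : F A) :
  sf_map g (eval_dual f) = eval_dual (sf_map g f).
Proof. by apply: fmod_hom_at_eq => S s p /=; rewrite sf_map_comp. Qed.

Lemma eval_dualD (F : fmodule k) (B : calg k) (f g : F B) :
  eval_dual (madd (fm_mod F B) f g) =
  madd (fm_mod (fdual (fdual F)) B) (eval_dual f) (eval_dual g).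
Proof. by apply: fmod_hom_at_eq => S s p /=; rewrite fm_mapD appD. Qed.

Lemma eval_dualZ (F : fmodule k) (B : calg k) (b : B) (f : F B) :
  eval_dual (mscale (fm_mod F B) b f) =
  mscale (fm_mod (fdual (fdual F)) B) b (eval_dual f).
Proof. by apply: fmod_hom_at_eq => S s p /=; rewrite fm_mapZ appZ. Qed.

(** A functional on N^** is known on the elements [eval_dual n], which are all of N^** when N is
    reflexive; so it is evaluation at its own restriction to N. *)
Lemma reflexive_dual (N : fmodule k) : freflexive N -> freflexive (fdual N).
Proof.
move=> Nr B; split=> [P|f f' ff'].
  unshelve eexists (@FModHomAt k N (base k) B
    (fun S s n => app (sf_map s P) (eval_dual n)) _ _ _).
  - by move=> S T s g n; cbv beta; rewrite sf_map_comp -eval_dual_map app_nat.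
  - by move=> S s m n; cbv beta; rewrite -[RHS]/(_ + _) -appD eval_dualD.
  - by move=> S s a n; cbv beta; rewrite -[RHS]/(_ * _) -appZ eval_dualZ.
  move=> S s p; have [n np] := proj1 (Nr S) p.
  have -> : p = eval_dual n.
    by apply: dual_eq => T t q; rewrite np eval_dual_map app_eval_dual.
  by rewrite app_eval_dual -[RHS]fmhE.
apply: dual_eq => S s n.
by rewrite -app_eval_dual ff' app_eval_dual.
Qed.
End Affine.

(** * Square-zero extensions and reflexivity of E (x) - *)

Definition rmorph_of (R S : pzRingType) (f : R -> S) (fA : zmod_morphism f)
    (fM : monoid_morphism f) : {rmorphism R -> S} :=
  HB.pack f (GRing.isZmodMorphism.Build R S f fA)
    (GRing.isMonoidMorphism.Build R S f fM).

Definition linear_of (k : pzRingType) (U V : lmodType k) (f : U -> V)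
    (fL : linear f) : {linear U -> V} :=
  HB.pack f (GRing.isLinear.Build k U V _ f fL).

Definition calg_hom_of (k : comPzRingType) (A B : calg k) (f : A -> B)
    (fA : zmod_morphism f) (fM : monoid_morphism f)
    (fE : forall r, f (alg_map A r) = alg_map B r) : calg_hom A B :=
  @CAlgHom k A B (rmorph_of fA fM) fE.

Definition calg_base (k : comPzRingType) : calg k := @CAlg k k (@idfun k).

Definition calg_unit (k : comPzRingType) (B : calg k) :
    calg_hom (calg_base k) B :=
  @CAlgHom k (calg_base k) B (alg_map B) (fun=> erefl).

Section SquareZero.
Variables (k : comPzRingType) (S : calg k) (N : lmodType S).

(** The ring S + N with N of square zero. It turns maps with values in a module into functionals
    with values in an algebra, to which naturality applies. *)
Definition sqz : Type := (S * N)%type.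
HB.instance Definition _ := GRing.Zmodule.on sqz.

Let mul (x y : sqz) : sqz := (x.1 * y.1, x.1 *: y.2 + y.1 *: x.2).

Fact sqz_mulA : associative mul.
Proof.
move=> [a m] [b n] [c p]; rewrite /mul /= mulrA; congr pair.
by rewrite !scalerDr !scalerA -!addrA (mulrC c a) (mulrC c b).
Qed.
Fact sqz_mulC : commutative mul.
Proof. by move=> [a m] [b n]; rewrite /mul /= mulrC addrC. Qed.
Fact sqz_mul1 : left_id (1, 0) mul.
Proof. by move=> [a m]; rewrite /mul /= mul1r scale1r scaler0 addr0. Qed.
Fact sqz_mulDl : left_distributive mul +%R.
Proof.
move=> [a m] [b n] [c p]; rewrite /mul /=; congr pair; first by rewrite mulrDl.
by rewrite /= scalerDl scalerDr addrACA.
Qed.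

HB.instance Definition _ := GRing.Zmodule_isComPzRing.Build sqz
  sqz_mulA sqz_mulC sqz_mul1 sqz_mulDl.

Lemma sqzB (x y : sqz) : x - y = (x.1 - y.1, x.2 - y.2).
Proof. by []. Qed.
Lemma sqzM (x y : sqz) : x * y = (x.1 * y.1, x.1 *: y.2 + y.1 *: x.2).
Proof. by []. Qed.

Definition sqz_in (a : S) : sqz := (a, 0).

Fact sqz_in_zmod : zmod_morphism sqz_in.
Proof. by move=> a b; congr pair; rewrite subr0. Qed.
Fact sqz_in_monoid : monoid_morphism sqz_in.
Proof.
by split=> // a b; rewrite sqzM /= !scaler0 addr0.
Qed.

Definition sqz_alg : calg k :=
  @CAlg k sqz (rmorph_of sqz_in_zmod sqz_in_monoid \o alg_map S).

Definition sqz_inj : calg_hom S sqz_alg :=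
  @calg_hom_of k S sqz_alg sqz_in sqz_in_zmod sqz_in_monoid (fun=> erefl).
End SquareZero.

Section SquareZeroMap.
Variables (k : comPzRingType) (S T : calg k) (M : lmodType S) (N : lmodType T).
Variables (s : calg_hom S T) (f : M -> N).
Hypothesis fD : forall x y, f (x - y) = f x - f y.
Hypothesis fZ : forall a x, f (a *: x) = s a *: f x.

Definition sqz_map_fun (x : sqz_alg M) : sqz_alg N := (s x.1, f x.2).

Fact sqz_map_zmod : zmod_morphism sqz_map_fun.
Proof.
move=> [a m] [b n]; rewrite /sqz_map_fun /=.
by rewrite sqzB /= rmorphB fD.
Qed.
Fact sqz_map_monoid : monoid_morphism sqz_map_fun.
Proof.
have f0 : f 0 = 0 by rewrite -(subrr 0) fD subrr.
have fA x y : f (x + y) = f x + f y.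
  by rewrite -{1}[y]opprK fD -[- y]sub0r fD f0 sub0r opprK.
split=> [|[a m] [b n]]; first by rewrite /sqz_map_fun /= rmorph1 f0.
by rewrite /sqz_map_fun sqzM /= rmorphM fA !fZ.
Qed.

Definition sqz_map : calg_hom (sqz_alg M) (sqz_alg N).
Proof.
apply: (calg_hom_of sqz_map_zmod sqz_map_monoid) => r.
have f0 : f 0 = 0 by rewrite -(subrr 0) fD subrr.
by congr pair => //; rewrite /= calg_funE.
Defined.
End SquareZeroMap.

Section QcDual.
Variables (k : comPzRingType) (E : lmodType k).

(** Together with [dual_of] this identifies the dual of E (x) - over [B] with the k-linear maps from
    E to B. *)
Definition co (B : calg k) (p : fdual (qc E) B) (e : E) : B := app p (pure e 1).

Lemma app_pure (B : calg k) (p : fdual (qc E) B) (e : E) (b : B) :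
  app p (pure e b) = b * co p e.
Proof. by rewrite -appZ /= tensZ_pure mulr1. Qed.

Lemma co_linear (B : calg k) (p : fdual (qc E) B) : linear (co p : E -> alg_mod B).
Proof.
move=> r e e'; rewrite /co pureDl pureZ appD app_pure; congr (_ + _).
by rewrite mulr1.
Qed.

Definition coL (B : calg k) (p : fdual (qc E) B) : {linear E -> alg_mod B} :=
  linear_of (co_linear p).

Lemma co_map (B S : calg k) (s : calg_hom B S) (p : fdual (qc E) B) (e : E) :
  co (sf_map s p) e = s (co p e).
Proof.
by rewrite -app_nat /co; congr (app _ _); rewrite [RHS]tens_map_pure rmorph1.
Qed.

Lemma app_tens (B S : calg k) (s : calg_hom B S) (p : fdual (qc E) S)
    (x : tensor E B) :
  app p (sf_map s (x : qc E B)) =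
  \sum_(i <- tens_repr x) s i.2 * co p i.1.
Proof.
rewrite -{1}[x]tens_reprK tens_of_sum.
elim: (tens_repr x) => [|[e b] l IHl].
  by rewrite !big_nil [sf_map _ _]tens_map0 (app0 p).
by rewrite !big_cons -IHl [sf_map _ _]tens_mapD (appD p) tens_map_pure app_pure.
Qed.

Lemma dual_qc_eq (B : calg k) (p q : fdual (qc E) B) : co p =1 co q -> p = q.
Proof.
move=> pq; apply: dual_eq => S s x.
rewrite -[x]tens_reprK tens_of_sum.
elim: (tens_repr x) => [|[e b] l IHl].
  by rewrite !big_nil (app0 (sf_map s p)) (app0 (sf_map s q)).
rewrite !big_cons (appD (sf_map s p)) (appD (sf_map s q)) IHl.
by rewrite !app_pure !co_map pq.
Qed.

Section DualOf.
Variables (B : calg k) (f : {linear E -> alg_mod B}).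

Fact dual_of_bal (S : calg k) (s : calg_hom B S) :
  balanced (fun (e : E) (t : S) => t * s (f e : B)).
Proof.
split=> [e e' b|e b b'|r e b|b].
- by rewrite linearD rmorphD mulrDr.
- by rewrite mulrDl.
- by rewrite linearZ /= alg_scaleE rmorphM calg_funE mulrCA mulrA.
- by rewrite linear0 rmorph0 mulr0.
Qed.

Definition dual_of : fdual (qc E) B.
Proof.
unshelve refine (@FModHomAt k (qc E) (base k) B
  (fun S s => tens_lift (fun (e : E) (t : S) => t * s (f e : B))) _ _ _).
- move=> S T s g; apply: tens_ind => [|x y IHx IHy|e b].
  + by rewrite [sf_map _ _]tens_map0 (tens_lift0 (dual_of_bal (calg_comp g s)))
      (tens_lift0 (dual_of_bal s)) [RHS]rmorph0.
  + rewrite [sf_map _ _ in LHS]tens_mapD (tens_liftD (dual_of_bal (calg_comp g s)))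
      (tens_liftD (dual_of_bal s)) IHx IHy.
    by rewrite [RHS]rmorphD.
  + rewrite [sf_map _ _ in LHS]tens_map_pure (tens_lift_pure (dual_of_bal (calg_comp g s)))
      (tens_lift_pure (dual_of_bal s)).
    by rewrite [RHS]rmorphM.
- by move=> S s; apply: (tens_liftD (dual_of_bal s)).
- move=> S s a; apply: tens_ind => [|x y IHx IHy|e b].
  + by rewrite [mscale _ _ _]scaler0 (tens_lift0 (dual_of_bal s)) [RHS]mulr0.
  + rewrite [mscale _ _ _ in LHS]scalerDr !(tens_liftD (dual_of_bal s)) [LHS]/=.
    by rewrite IHx IHy [RHS]mulrDr.
  + rewrite [mscale _ _ _ in LHS]tensZ_pure !(tens_lift_pure (dual_of_bal s)).
    by rewrite [RHS]mulrA.
Defined.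

Lemma co_dual_of (e : E) : co dual_of e = f e.
Proof.
by rewrite [LHS](tens_lift_pure (dual_of_bal (calg_id B))) mul1r.
Qed.
End DualOf.

(** The functional [g] that sends e to (0, e (x) 1) is universal: any functional [w] over a
    B-algebra becomes, after multiplication by eps, the image of [g] under a ring morphism.
    Naturality then recovers all of [P] from its value at [g]. *)
Lemma qc_reflexive : freflexive (qc E).
Proof.
move=> B.
pose T := sqz_alg (tensor E B).
have gL : linear (fun e : E => (0, pure e 1) : alg_mod T).
  move=> r e e'; congr pair; first by rewrite /= mulr0 addr0.
  by rewrite pureDl pureZ /= scale0r addr0 tensZ_pure.
pose g := dual_of (linear_of gL).
pose i : calg_hom B T := sqz_inj _.
have gE (n : tensor E B) : app g (sf_map i (n : qc E B)) = (0, n).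
  rewrite app_tens -[n in RHS]tens_reprK tens_of_sum.
  elim: (tens_repr n) => [|[e b] l IHl]; first by rewrite !big_nil.
  rewrite !big_cons IHl co_dual_of; congr pair; first by rewrite /= mulr0 addr0.
  by rewrite /= scale0r addr0 tensZ_pure mulr1.
split=> [P|n n' nn']; last by have := nn' T i g; rewrite !gE => -[].
(* The module component of P(g) is the representing element. *)
pose n : tensor E B := (app (sf_map i P) g : T).2.
exists n => S s w.
pose D := sqz_alg (S : comPzRingType)^o.
pose j : calg_hom S D := sqz_inj _.
pose f (x : tensor E B) : S^o := app w (sf_map s (x : qc E B)).
have fD x y : f (x - y) = f x - f y.
  apply/eqP; rewrite -[f x - f y]/(f x + - f y) -subr_eq opprK.
  by rewrite /f -appD -fm_mapD [madd _ _ _]subrK.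
have f0 : f 0 = 0 by rewrite -(subrr 0) fD subrr.
have fZ a x : f (a *: x) = s a *: f x.
  by rewrite /f -[a *: x]/(mscale (fm_mod (qc E) B) a x) fm_mapZ appZ.
(* In the dual numbers over S, [h] is (b, x) |-> s(b) + w(x) eps. *)
pose h : calg_hom T D := sqz_map fD fZ.
have hi : calg_comp h i = calg_comp j s.
  by apply: calg_hom_eq => b; congr pair; exact: f0.
pose eps : D := (0, 1).
have hg : sf_map h g = mscale (fm_mod (fdual (qc E)) D) eps (sf_map j w).
  apply: dual_qc_eq => e; rewrite co_map co_dual_of [RHS]/co app_scalel -/(co _ _).
  rewrite co_map; congr pair; first by rewrite /= rmorph0 mul0r.
  by rewrite /= scaler0 add0r [RHS]mulr1 /f [sf_map _ _]tens_map_pure rmorph1.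
(* Naturality along [h] reads eps P(w) = h(P(g)); the coefficients of eps give P(w) = w(n). *)
have := app_nat h (sf_map i P) g.
rewrite -sf_map_comp hi sf_map_comp hg (appZ (sf_map j _)) app_nat.
case=> _ /=; rewrite scaler0 add0r => e.
by rewrite -[LHS]mulr1; exact: e.
Qed.
End QcDual.

(** * Base change of algebras and the Yoneda lemma *)

Section TensorCoproduct.
Variables (k : comPzRingType) (A B : calg k).
Local Notation T := (tensor (alg_mod A) B).

Definition tens_inl_fun (a : A) : T := pure (a : alg_mod A) 1.
Definition tens_inr_fun (b : B) : T := pure ((1 : A) : alg_mod A) b.

Fact tens_inl_zmod : zmod_morphism tens_inl_fun.
Proof.
move=> a a'; apply/eqP; rewrite eq_sym subr_eq; apply/eqP.
by rewrite -pureDl; congr pure; rewrite [RHS]subrK.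
Qed.
Fact tens_inl_monoid : monoid_morphism tens_inl_fun.
Proof. by split=> // a a'; rewrite [RHS]tensM_pure mulr1. Qed.
Fact tens_inr_zmod : zmod_morphism tens_inr_fun.
Proof.
by move=> b b'; apply/eqP; rewrite eq_sym subr_eq -pureDr subrK.
Qed.
Fact tens_inr_monoid : monoid_morphism tens_inr_fun.
Proof. by split=> // b b'; rewrite [RHS]tensM_pure mulr1. Qed.

Definition tens_alg : calg k :=
  @CAlg k T (rmorph_of tens_inr_zmod tens_inr_monoid \o alg_map B).

Definition tens_inr : calg_hom B tens_alg :=
  @calg_hom_of k B tens_alg _ tens_inr_zmod tens_inr_monoid (fun=> erefl).

Definition tens_inl : calg_hom A tens_alg.
Proof.
apply: (@calg_hom_of k A tens_alg _ tens_inl_zmod tens_inl_monoid) => r.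
rewrite /tens_inl_fun -[alg_map A r]mulr1 -alg_scaleE pureZ mulr1.
by [].
Defined.

Section Copair.
Variables (C : calg k) (f : calg_hom A C) (g : calg_hom B C).

Definition tens_copair_fun : tens_alg -> C :=
  tens_lift (fun (a : alg_mod A) (b : B) => (f a : C) * g b).

Fact tens_copair_bal :
  balanced (fun (a : alg_mod A) (b : B) => (f a : C) * g b).
Proof.
split=> [a a' b|a b b'|r a b|b].
- by rewrite [f _]rmorphD mulrDl.
- by rewrite rmorphD mulrDr.
- by rewrite alg_scaleE !rmorphM !calg_funE mulrCA mulrA.
- by rewrite [f _]rmorph0 mul0r.
Qed.

Lemma tens_copair_pure (a : A) (b : B) :
  tens_copair_fun (pure (a : alg_mod A) b) = f a * g b.
Proof. exact: (tens_lift_pure tens_copair_bal). Qed.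

Lemma tens_copair0 : tens_copair_fun 0 = 0.
Proof. exact: (tens_lift0 tens_copair_bal). Qed.

Lemma tens_copairD (x y : tens_alg) :
  tens_copair_fun (x + y) = tens_copair_fun x + tens_copair_fun y.
Proof. exact: (tens_liftD tens_copair_bal). Qed.

Fact tens_copair_zmod : zmod_morphism tens_copair_fun.
Proof.
by move=> x y; apply/eqP; rewrite eq_sym subr_eq -tens_copairD subrK.
Qed.

Fact tens_copair_monoid : monoid_morphism tens_copair_fun.
Proof.
split=> [|x y]; first by rewrite tens_copair_pure !rmorph1 mulr1.
move: x; apply: tens_ind => [|x x' IHx IHx'|a b].
- by rewrite mul0r tens_copair0 mul0r.
- by rewrite mulrDl !tens_copairD mulrDl IHx IHx'.
move: y; apply: tens_ind => [|y y' IHy IHy'|a' b'].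
- by rewrite mulr0 tens_copair0 mulr0.
- by rewrite mulrDr !tens_copairD mulrDr IHy IHy'.
by rewrite tensM_pure !tens_copair_pure !rmorphM mulrACA.
Qed.

Definition tens_copair : calg_hom tens_alg C.
Proof.
apply: (calg_hom_of tens_copair_zmod tens_copair_monoid) => r.
by rewrite [LHS]tens_copair_pure rmorph1 mul1r calg_funE.
Defined.

Lemma tens_copair_inl : calg_comp tens_copair tens_inl = f.
Proof.
by apply: calg_hom_eq => a; rewrite [LHS]tens_copair_pure rmorph1 mulr1.
Qed.

Lemma tens_copair_inr : calg_comp tens_copair tens_inr = g.
Proof.
by apply: calg_hom_eq => b; rewrite [LHS]tens_copair_pure rmorph1 mul1r.
Qed.
End Copair.
End TensorCoproduct.

Section SpecEquiv.
Variable k : comPzRingType.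

(** The value of [qc_alg B] at S is B (x) S; for a B-algebra S it contracts to S by b (x) t |-> s(b)
    t. *)
Definition copair_lin (B S : calg k) (s : calg_hom B S) :
    calg_hom (tens_alg B S) S := tens_copair s (calg_id S).

Lemma copair_lin_nat (B S T : calg k) (s : calg_hom B S) (g : calg_hom S T)
    (x : tensor (alg_mod B) S) :
  copair_lin (calg_comp g s) (tens_map (@idfun (alg_mod B)) g x) =
  g (copair_lin s x).
Proof.
move: x; apply: tens_ind => [|x y IHx IHy|b t].
- by rewrite tens_map0 !rmorph0.
- by rewrite tens_mapD !rmorphD IHx IHy.
- by rewrite tens_map_pure [LHS]tens_copair_pure [copair_lin _ _]tens_copair_pure
    rmorphM.
Qed.

Lemma copair_linZ (B S : calg k) (s : calg_hom B S) (a : S)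
    (x : tensor (alg_mod B) S) : copair_lin s (a *: x) = a * copair_lin s x.
Proof.
move: x; apply: tens_ind => [|x y IHx IHy|b t].
- by rewrite scaler0 rmorph0 mulr0.
- by rewrite scalerDr !rmorphD mulrDr IHx IHy.
- by rewrite tensZ_pure ![copair_lin _ _]tens_copair_pure mulrCA.
Qed.

Variable F : falgebra k.

Definition fspec_of_spec (B : calg k) (u : Spec F B) : fspec F B.
Proof.
unshelve eexists (@FModHomAt k F (base k) B
  (fun S s f => copair_lin s (fah_nat u S f)) _ _ _).
- by move=> S T s g f; cbv beta; rewrite sn_nat copair_lin_nat.
- by move=> S s f g; cbv beta; rewrite fah_add [LHS]rmorphD.
- by move=> S s a f; cbv beta; rewrite fah_scale [LHS]copair_linZ.
- by move=> S s f g; rewrite -!fmhE [LHS]/= fah_mul; apply: (rmorphM (copair_lin s)).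
- by move=> S s; rewrite -!fmhE [LHS]/= fah_one; apply: (rmorph1 (copair_lin s)).
Defined.

Fact fspec_of_spec_nat (A B : calg k) (g : calg_hom A B) (u : Spec F A) :
  fspec_of_spec (sf_map g u) = sf_map g (fspec_of_spec u).
Proof.
apply: spec_at_eq; apply: fmod_hom_at_eq => S s f /=.
move: (fah_nat u S f); apply: tens_ind => [|x y IHx IHy|b t].
- by rewrite tens_map0 !tens_copair0.
- by rewrite tens_mapD !tens_copairD IHx IHy.
- by rewrite tens_map_pure !tens_copair_pure.
Qed.

Section SpecOfFspec.
Variables (B : calg k) (h : fspec F B).

(** [h] lives over B and [f] over S, so both are moved to B (x) S before they are paired. *)
Definition spec_of_fspec_fun (S : calg k) (f : F S) : tens_alg B S :=
  app (sf_map (tens_inl B S) (sp_lin h)) (sf_map (tens_inr B S) f).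

Fact spec_of_fspec_nat (S T : calg k) (g : calg_hom S T) (f : F S) :
  spec_of_fspec_fun (sf_map g f) =
  tens_map (@idfun (alg_mod B)) g (spec_of_fspec_fun f).
Proof.
pose G : calg_hom (tens_alg B S) (tens_alg B T) :=
  tens_copair (tens_inl B T) (calg_comp (tens_inr B T) g).
have -> (x : tens_alg B S) : tens_map (@idfun (alg_mod B)) g x = G x.
  move: x; apply: tens_ind => [|x y IHx IHy|b t].
  - by rewrite tens_map0 rmorph0.
  - by rewrite tens_mapD rmorphD IHx IHy.
  - rewrite tens_map_pure [RHS]tens_copair_pure [RHS]tensM_pure.
    by rewrite mulr1 mul1r.
rewrite /spec_of_fspec_fun -app_nat -!sf_map_comp.
by rewrite /G tens_copair_inl tens_copair_inr.
Qed.

Definition spec_of_fspec : Spec F B.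
Proof.
unshelve refine (@FAlgHom k F (qc_alg B)
  (@SNat k F (qc_alg B) spec_of_fspec_fun spec_of_fspec_nat) _ _ _ _).
- by move=> S x y; rewrite /= /spec_of_fspec_fun fm_mapD appD.
- move=> S a x; rewrite /= /spec_of_fspec_fun fm_mapZ appZ.
  move: (app _ _ : tens_alg B S); apply: tens_ind => [|y z IHy IHz|b t].
  + by rewrite mulr0 scaler0.
  + by rewrite mulrDr scalerDr IHy IHz.
  + by rewrite [LHS]tensM_pure tensZ_pure mul1r.
- by move=> S x y; rewrite /= /spec_of_fspec_fun amap_mul sp_mul.
- by move=> S; rewrite /= /spec_of_fspec_fun amap_one sp_one.
Defined.
End SpecOfFspec.

(** Because B (x) S is the coproduct of B and S, morphisms to B (x) - correspond to functionals over
    B: contraction by [copair_lin] gives one direction, evaluation over B (x) S the other. *)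
Lemma spec_fspec : siso (Spec F) (fspec F).
Proof.
apply: (@siso_bij _ _ _ (SNat fspec_of_spec_nat)) => B /=.
- apply: (can_inj (g := @spec_of_fspec B)) => u; apply: falg_hom_eq => S f.
  change (app (sf_map (tens_inl B S) (sp_lin (fspec_of_spec u)))
    (sf_map (tens_inr B S) f) = fah_nat u S f).
  rewrite -fmhE [LHS]/= sn_nat.
  move: (fah_nat u S f); apply: tens_ind => [|x y IHx IHy|b t].
  + by rewrite [sf_map _ _]tens_map0 tens_copair0.
  + by rewrite [sf_map _ _]tens_mapD tens_copairD IHx IHy.
  + rewrite [sf_map _ _]tens_map_pure [LHS]tens_copair_pure [LHS]tensM_pure.
    by rewrite mulr1 mul1r.
- move=> h; exists (spec_of_fspec h); apply: spec_at_eq.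
  apply: fmod_hom_at_eq => S s f.
  change (copair_lin s (app (sf_map (tens_inl B S) (sp_lin h))
    (sf_map (tens_inr B S) f)) = fmh_fun (sp_lin h) s f).
  rewrite -app_nat -!sf_map_comp tens_copair_inl tens_copair_inr.
  by rewrite sf_map_id fmhE.
Qed.
End SpecEquiv.

Section Yoneda.
Variables (k : comPzRingType) (A : calg k).

Definition qc_point (R : calg k) (a : calg_hom A R) : fspec (qc_alg A) R.
Proof.
unshelve eexists (@FModHomAt k (qc_alg A) (base k) R
  (fun S s x => copair_lin (calg_comp s a) x) _ _ _).
- by move=> S T s g x; cbv beta; rewrite -calg_compA copair_lin_nat.
- by move=> S s x y; apply: (rmorphD (copair_lin _)).
- by move=> S s b x; apply: copair_linZ.
- by move=> S s x y; rewrite -!fmhE; apply: (rmorphM (copair_lin _)).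
- by move=> S s; rewrite -!fmhE; apply: (rmorph1 (copair_lin _)).
Defined.

(** Yoneda over B: the inclusion of A in R = A (x) B is the universal point, and a function is
    determined by its value there, which is an element of R, the value of [qc_alg A] at B. *)
Lemma qc_alg_affine : faffine (qc_alg A).
Proof.
move=> B; pose R := tens_alg A B.
(* Every point comes from the algebra morphism a |-> h(a (x) 1). *)
have hE (S : calg k) (s : calg_hom B S) (h : fspec (qc_alg A) S) :
    exists a : calg_hom A S, h = qc_point a.
  have aZ : zmod_morphism (fun a : A => co (sp_lin h) (a : alg_mod A)).
    by move=> a a'; apply: (linearB (coL (sp_lin h))).
  have aM : monoid_morphism (fun a : A => co (sp_lin h) (a : alg_mod A)).
    split=> [|a a']; first exact: (spec1 h).
    apply: etrans (specM h (pure (a : alg_mod A) 1 : qc_alg A S)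
      (pure (a' : alg_mod A) 1)).
    by rewrite [amul _ _ _]tensM_pure mulr1.
  have aE r : co (sp_lin h) (alg_map A r : alg_mod A) = alg_map S r.
    rewrite -[alg_map A r]mulr1 -alg_scaleE [LHS](linearZ_LR (coL (sp_lin h))).
    by rewrite alg_scaleE /= /co [X in _ * X](spec1 h) mulr1.
  exists (calg_hom_of aZ aM aE); apply: spec_at_eq; apply: dual_qc_eq => a.
  by rewrite [RHS]tens_copair_pure rmorph1 mulr1.
split=> [P|f f' ff'].
  exists (P R (tens_inr A B) (qc_point (tens_inl A B))) => S s h.
  have [a ->] := hE S s h.
  pose c : calg_hom R S := tens_copair a s.
  have -> : qc_point a = sf_map c (qc_point (tens_inl A B)).
    apply: spec_at_eq; apply: fmod_hom_at_eq => T t x /=.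
    by rewrite -calg_compA tens_copair_inl.
  rewrite -[s in LHS](tens_copair_inr a s) fa_nat.
  move: (P R _ _ : R); apply: tens_ind => [|x y IHx IHy|d b].
  - by rewrite rmorph0 [sf_map s _]tens_map0 (app0 (sp_lin _)).
  - by rewrite rmorphD [sf_map s _ in RHS]tens_mapD (appD (sp_lin _)) IHx IHy.
  - rewrite [LHS]tens_copair_pure [sf_map s _ in RHS]tens_map_pure.
    by rewrite [RHS]tens_copair_pure /= tens_copair_pure rmorph1 mulr1.
(* Evaluation at the universal point returns the element itself, whence uniqueness. *)
have fE (x : tensor (alg_mod A) B) :
    app (sp_lin (qc_point (tens_inl A B))) (sf_map (tens_inr A B) (x : qc_alg A B)) = x.
  move: x; apply: tens_ind => [|x y IHx IHy|a b].
  - by rewrite [sf_map (tens_inr A B) _]tens_map0 (app0 (sp_lin _)).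
  - by rewrite [sf_map (tens_inr A B) _ in LHS]tens_mapD (appD (sp_lin _)) IHx IHy.
  - rewrite [sf_map (tens_inr A B) _ in LHS]tens_map_pure [LHS]tens_copair_pure.
    by rewrite [LHS]tensM_pure mulr1 mul1r.
by rewrite -[f]fE ff' fE.
Qed.
End Yoneda.

(** * Dual bases of projective modules *)

Section DualBasis.
Variables (k : comPzRingType) (C : lmodType k).

(** Finitely supported functions form the free module on the set C; projectivity will split its
    canonical surjection onto C. *)
Definition finsupp_pred : {pred C -> k^o} :=
  fun f => `[< exists s : seq C, forall x, f x != 0 -> x \in s >].

Fact finsupp_submod : submod_closed finsupp_pred.
Proof.
split=> [|a f g /asboolP[s fs] /asboolP[t gt]]; apply/asboolP.
  by exists [::] => x; rewrite eqxx.
exists (s ++ t) => x; rewrite mem_cat; apply: contraNT; rewrite negb_or.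
move=> /andP[xs xt]; rewrite -[_ x]/(a * f x + g x).
rewrite (contraNeq (@fs x) xs) (contraNeq (@gt x) xt) mulr0 addr0.
by [].
Qed.
HB.instance Definition _ :=
  GRing.isSubmodClosed.Build k (C -> k^o) finsupp_pred finsupp_submod.

Record finsupp := FinSupp {
  finsupp_fun :> C -> k^o;
  finsuppP : finsupp_fun \in finsupp_pred
}.
HB.instance Definition _ := [isSub for finsupp_fun].
HB.instance Definition _ := [Choice of finsupp by <:].
HB.instance Definition _ := [SubChoice_isSubLmodule of finsupp by <:].

Definition covers (s : seq C) (f : finsupp) : Prop :=
  uniq s /\ forall x, f x != 0 -> x \in s.

(** Terms outside the support vanish, so each side is the sum over the support up to order. Hence
    [finsupp_sum] does not depend on the chosen list. *)
Lemma covers_sum (f : finsupp) (s t : seq C) : covers s f -> covers t f ->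
  \sum_(x <- s) f x *: x = \sum_(x <- t) f x *: x.
Proof.
move=> [us fs] [ut ft].
have E (r : seq C) : \sum_(x <- r) f x *: x =
    \sum_(x <- [seq x <- r | f x != 0]) f x *: x.
  rewrite big_filter [RHS]big_mkcond; apply: eq_bigr => x _.
  by case: eqP => [->|//]; rewrite scale0r.
rewrite E [RHS]E; apply: perm_big; apply: uniq_perm; rewrite ?filter_uniq // => x.
rewrite !mem_filter; case: (boolP (f x != 0)) => //= fx.
by rewrite (fs x fx) (ft x fx).
Qed.

Fact finsupp_cover (f : finsupp) : exists s, covers s f.
Proof.
have /asboolP[s fs] := finsuppP f; exists (undup s).
by split=> [|x /fs]; rewrite ?undup_uniq // mem_undup.
Qed.

Definition finsupp_sum (f : finsupp) : C :=
  \sum_(x <- sval (cid (finsupp_cover f))) f x *: x.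

Lemma finsupp_sumE (f : finsupp) (s : seq C) : covers s f ->
  finsupp_sum f = \sum_(x <- s) f x *: x.
Proof. exact/covers_sum/(svalP (cid (finsupp_cover f))). Qed.

Fact finsupp_sum_linear : linear finsupp_sum.
Proof.
move=> a f g; have [s [_ fs]] := finsupp_cover f.
have [t [_ gt]] := finsupp_cover g.
have us : uniq (undup (s ++ t)) by rewrite undup_uniq.
have [cf cg] : covers (undup (s ++ t)) f /\ covers (undup (s ++ t)) g.
  split; split=> // x; rewrite mem_undup mem_cat; first by move/fs->.
  by move/gt->; rewrite orbT.
rewrite (finsupp_sumE cf) (finsupp_sumE cg) (@finsupp_sumE _ (undup (s ++ t))).
  rewrite scaler_sumr -big_split; apply: eq_bigr => x _.
  by rewrite scalerA; apply: scalerDl.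
split=> // x; rewrite -[_ x]/(a * f x + g x); apply: contraNT => xn.
rewrite (contraNeq (proj2 cf x) xn) (contraNeq (proj2 cg x) xn) mulr0 addr0.
by [].
Qed.

(** A linear section [h] of the surjection from the free module writes y as the sum of its
    coordinates h(y)(x) times x. Since [Y] is finite, the supports of all h(y) lie in one finite
    list, which indexes the family. *)
Lemma dual_basis (Y : seq C) : projective C ->
  exists l : seq ({linear C -> k^o} * C),
    forall y, y \in Y -> y = \sum_(i <- l) i.1 y *: i.2.
Proof.
move=> Cproj.
have surj y : exists f, linear_of finsupp_sum_linear f = y.
  have yP : (fun x => if x == y then 1 else 0) \in finsupp_pred.
    apply/asboolP; exists [:: y] => x; rewrite inE.
    by case: (x == y) => //; rewrite eqxx.
  exists (FinSupp yP); rewrite /= (@finsupp_sumE _ [:: y]).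
    by rewrite big_seq1 /= eqxx scale1r.
  by split=> // x; rewrite inE /=; case: (x == y) => //; rewrite eqxx.
have [h hK] := Cproj _ _ (linear_of finsupp_sum_linear) (@idfun C) surj.
have coordL x : linear (fun c => h c x : k^o) by move=> a c d; rewrite linearP.
pose s := undup (flatten [seq sval (cid (finsupp_cover (h y))) | y <- Y]).
exists [seq (linear_of (coordL x), x) | x <- s] => y Yy.
rewrite big_map /= -[LHS]hK; apply: finsupp_sumE; split; first exact: undup_uniq.
move=> x /(proj2 (svalP (cid (finsupp_cover (h y))))) xs.
rewrite mem_undup; apply/flattenP; exists (sval (cid (finsupp_cover (h y)))) => //.
exact: map_f.
Qed.
End DualBasis.

(** * Quotient rings; testing multiplicativity *)

Record ideal (R : comPzRingType) (I : R -> Prop) : Prop := Ideal {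
  ideal0 : I 0;
  idealD : forall x y, I x -> I y -> I (x + y);
  idealM : forall x y, I y -> I (x * y)
}.

Section IdealQuotient.
Variables (R : comPzRingType) (I : R -> Prop) (idI : ideal I).

Let idealN x : I x -> I (- x).
Proof. by rewrite -mulN1r; apply: idealM. Qed.

Definition ideal_eqv (x y : R) : bool := `[< I (x - y) >].

Fact ideal_eqv_refl : reflexive ideal_eqv.
Proof. by move=> x; apply/asboolP; rewrite subrr; apply: ideal0. Qed.
Fact ideal_eqv_sym : symmetric ideal_eqv.
Proof.
by move=> x y; apply/asboolP/asboolP => /idealN; rewrite opprB.
Qed.
Fact ideal_eqv_trans : transitive ideal_eqv.
Proof.
move=> y x z /asboolP xy /asboolP yz; apply/asboolP.
by rewrite -(subrKA y); apply: idealD.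
Qed.

Canonical ideal_equiv :=
  EquivRel ideal_eqv ideal_eqv_refl ideal_eqv_sym ideal_eqv_trans.

Definition idquot : Type := {eq_quot ideal_equiv}.
Local Notation Q := idquot.
HB.instance Definition _ := Choice.on Q.

Definition idcl (x : R) : Q := \pi_({eq_quot ideal_equiv}) x.
Definition idrepr (q : Q) : R := repr (q : {eq_quot ideal_equiv}).

Lemma idreprK q : idcl (idrepr q) = q.
Proof. exact: reprK. Qed.

Lemma idclP x y : idcl x = idcl y <-> I (x - y).
Proof.
split=> [/eqmodP /asboolP//|xy].
by apply/eqmodP; apply/asboolP.
Qed.

Lemma idclK x : I (idrepr (idcl x) - x).
Proof. by apply/idclP; rewrite idreprK. Qed.

Let add (p q : Q) : Q := idcl (idrepr p + idrepr q).
Let opp (p : Q) : Q := idcl (- idrepr p).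
Let mul (p q : Q) : Q := idcl (idrepr p * idrepr q).

Let addE x y : add (idcl x) (idcl y) = idcl (x + y).
Proof. by apply/idclP; rewrite opprD addrACA; apply: (idealD idI); apply: idclK. Qed.
Let oppE x : opp (idcl x) = idcl (- x).
Proof. by apply/idclP; rewrite -opprD; apply/idealN/idclK. Qed.
Let mulE x y : mul (idcl x) (idcl y) = idcl (x * y).
Proof.
apply/idclP; rewrite -(subrKA (idrepr (idcl x) * y)) -mulrBr -mulrBl.
apply: (idealD idI); last rewrite [X in I X]mulrC;
  apply: (idealM idI); exact: idclK.
Qed.

Fact idquot_addA : associative add.
Proof.
by move=> p q r; rewrite -[p]idreprK -[q]idreprK -[r]idreprK !addE addrA.
Qed.
Fact idquot_addC : commutative add.
Proof. by move=> p q; rewrite -[p]idreprK -[q]idreprK !addE addrC. Qed.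
Fact idquot_add0 : left_id (idcl 0) add.
Proof. by move=> p; rewrite -[p]idreprK addE add0r. Qed.
Fact idquot_addN : left_inverse (idcl 0) opp add.
Proof. by move=> p; rewrite -[p]idreprK oppE addE addNr. Qed.
HB.instance Definition _ := GRing.isZmodule.Build Q
  idquot_addA idquot_addC idquot_add0 idquot_addN.

Fact idquot_mulA : associative mul.
Proof.
by move=> p q r; rewrite -[p]idreprK -[q]idreprK -[r]idreprK !mulE mulrA.
Qed.
Fact idquot_mulC : commutative mul.
Proof. by move=> p q; rewrite -[p]idreprK -[q]idreprK !mulE mulrC. Qed.
Fact idquot_mul1 : left_id (idcl 1) mul.
Proof. by move=> p; rewrite -[p]idreprK mulE mul1r. Qed.
Fact idquot_mulDl : left_distributive mul add.
Proof.
move=> p q r; rewrite -[p]idreprK -[q]idreprK -[r]idreprK.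
by rewrite !(addE, mulE) mulrDl.
Qed.
HB.instance Definition _ := GRing.Zmodule_isComPzRing.Build Q
  idquot_mulA idquot_mulC idquot_mul1 idquot_mulDl.

Fact idcl_zmod : zmod_morphism idcl.
Proof. by move=> x y; rewrite -[RHS]/(add _ (opp _)) oppE addE. Qed.
Fact idcl_monoid : monoid_morphism idcl.
Proof. by split=> // x y; rewrite -[RHS]/(mul _ _) mulE. Qed.
HB.instance Definition _ := GRing.isZmodMorphism.Build R Q idcl idcl_zmod.
HB.instance Definition _ := GRing.isMonoidMorphism.Build R Q idcl idcl_monoid.

Section Lift.
Variables (T : comPzRingType) (g : {rmorphism R -> T}).
Hypothesis gI : forall x, I x -> g x = 0.

Definition idquot_lift (q : Q) : T := g (idrepr q).

Lemma idquot_lift_cl x : idquot_lift (idcl x) = g x.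
Proof. by apply/eqP; rewrite -subr_eq0 -rmorphB; apply/eqP/gI/idclK. Qed.

Fact idquot_lift_zmod : zmod_morphism idquot_lift.
Proof.
move=> p q; rewrite -[p]idreprK -[q]idreprK -rmorphB !idquot_lift_cl.
exact: rmorphB.
Qed.
Fact idquot_lift_monoid : monoid_morphism idquot_lift.
Proof.
split=> [|p q]; first by rewrite -(rmorph1 idcl) idquot_lift_cl rmorph1.
by rewrite -[p]idreprK -[q]idreprK -rmorphM !idquot_lift_cl rmorphM.
Qed.
End Lift.
End IdealQuotient.

Section DualMul.
Variables (k : comPzRingType) (F : falgebra k).

Definition dual_mulr (B : calg k) (h : fdual F B) (g : F B) : fdual F B.
Proof.
unshelve refine (@FModHomAt k F (base k) B
  (fun S s f => app (sf_map s h) (amul (fa_alg F) f (sf_map s g))) _ _ _).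
- by move=> S T s t f; cbv beta; rewrite !sf_map_comp -amap_mul app_nat.
- by move=> S s f f'; cbv beta; rewrite amulDl appD.
- by move=> S s a f; cbv beta; rewrite amulZl appZ.
Defined.

Lemma app_dual_mulr (B : calg k) (h : fdual F B) (f g : F B) :
  app (dual_mulr h g) f = app h (amul (fa_alg F) f g).
Proof.
rewrite -[LHS]/(app (sf_map (calg_id B) h) (amul _ f (sf_map (calg_id B) g))).
by rewrite !sf_map_id.
Qed.

(* Multiplicativity of a functional propagates from a family of elements on
   which functionals are determined: fix one factor, then the other. *)
Lemma dual_mult_sep (K : forall S : calg k, F S -> Prop) :
  alg_commutative (fa_alg F) ->
  (forall (S T : calg k) (t : calg_hom S T) f, K S f -> K T (sf_map t f)) ->
  (forall (S : calg k) (p q : fdual F S),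
    (forall (T : calg k) (t : calg_hom S T) f, K T f ->
       app (sf_map t p) f = app (sf_map t q) f) -> p = q) ->
  forall (B : calg k) (h : fdual F B),
  (forall (S : calg k) (s : calg_hom B S) f g, K S f -> K S g ->
     app (sf_map s h) (amul (fa_alg F) f g) =
     app (sf_map s h) f * app (sf_map s h) g) ->
  forall f g, app h (amul (fa_alg F) f g) = app h f * app h g.
Proof.
move=> FC Kmap sep B h hK.
have mulrE (S T : calg k) (t : calg_hom S T) (p : fdual F S) (g : F S) f :
    app (sf_map t (dual_mulr p g)) f =
    app (sf_map t p) (amul (fa_alg F) f (sf_map t g)).
  by rewrite -fmhE.
have scaleE (S T : calg k) (t : calg_hom S T) (p : fdual F S) (a : S) f :
    app (sf_map t (mscale (fm_mod (fdual F) S) a p)) f = t a * app (sf_map t p) f.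
  by rewrite -!fmhE.
have step (S : calg k) (s : calg_hom B S) f g : K S g ->
    app (sf_map s h) (amul (fa_alg F) f g) =
    app (sf_map s h) f * app (sf_map s h) g.
  move=> Kg; rewrite -app_dual_mulr mulrC -app_scalel; congr app; apply: sep.
  move=> T t f' Kf'; rewrite mulrE scaleE -app_nat -sf_map_comp.
  by rewrite hK //; [rewrite mulrC | apply: Kmap].
move=> f g; rewrite -app_dual_mulr mulrC -app_scalel; congr app; apply: sep.
move=> S s f' Kf'; rewrite mulrE scaleE -app_nat FC step //.
Qed.
End DualMul.

(** * Functions on the spectrum of an algebra scheme *)

Section QcDualFunctionals.
Variables (k : comPzRingType) (C : lmodType k).
Local Notation F := (fdual (qc C)).

Fact scalar_fun_linear (S : calg k) (phi : {linear C -> k^o}) :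
  linear (fun c => alg_map S (phi c) : alg_mod S).
Proof.
by move=> r c c'; rewrite linearP /= alg_scaleE -rmorphM -rmorphD.
Qed.

Definition scalar_fun (S : calg k) (phi : {linear C -> k^o}) : F S :=
  dual_of (linear_of (scalar_fun_linear S phi)).

Lemma co_scalar_fun (S : calg k) (phi : {linear C -> k^o}) (c : C) :
  co (scalar_fun S phi) c = alg_map S (phi c).
Proof. exact: co_dual_of. Qed.

Lemma scalar_fun_map (S T : calg k) (t : calg_hom S T) (phi : {linear C -> k^o}) :
  sf_map t (scalar_fun S phi) = scalar_fun T phi.
Proof.
by apply: dual_qc_eq => c; rewrite co_map !co_scalar_fun calg_funE.
Qed.

(** By reflexivity [h] is the pairing with an element of C (x) S, a finite sum of pure tensors. *)
Lemma dual_qc_support (S : calg k) (h : fdual F S) :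
  exists l : seq (C * S), forall (T : calg k) (t : calg_hom S T) (p : F T),
    app (sf_map t h) p = \sum_(i <- l) t i.2 * co p i.1.
Proof.
have [n nP] := proj1 (@qc_reflexive k C S) h.
by exists (tens_repr n) => T t p; rewrite nP app_tens.
Qed.

Lemma co_sum (S : calg k) (p : F S) (I : Type) (r : seq I) (a : I -> k) (c : I -> C) :
  co p (\sum_(i <- r) a i *: c i) = \sum_(i <- r) alg_map S (a i) * co p (c i).
Proof.
elim: r => [|i r IHr]; first by rewrite !big_nil; apply: (linear0 (coL p)).
by rewrite !big_cons -IHr; apply: (linearP (coL p)).
Qed.

Hypothesis Cproj : projective C.

(** Both functionals involve only finitely many elements of C. On these, a dual basis writes any [p]
    as a combination of scalar functionals, so values at scalar functionals suffice. *)
Lemma dual_qc_sep (S : calg k) (h h' : fdual F S) :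
  (forall phi, app h (scalar_fun S phi) = app h' (scalar_fun S phi)) -> h = h'.
Proof.
move=> hh'; have [l lP] := dual_qc_support h; have [l' lP'] := dual_qc_support h'.
have [b bP] := dual_basis ([seq i.1 | i <- l] ++ [seq i.1 | i <- l']) Cproj.
(* If (phi_j, c_j) is a dual basis covering the support of [g], then g(p) is the sum of the p(c_j)
   g(phi_j). *)
have E (m : seq (C * S)) (g : fdual F S) (T : calg k) (t : calg_hom S T) (p : F T) :
    {subset [seq i.1 | i <- m] <= [seq i.1 | i <- l] ++ [seq i.1 | i <- l']} ->
    (forall (T : calg k) (t : calg_hom S T) (p : F T),
       app (sf_map t g) p = \sum_(i <- m) t i.2 * co p i.1) ->
    app (sf_map t g) p = \sum_(j <- b) co p j.2 * t (app g (scalar_fun S j.1)).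
  move=> ml gP; rewrite gP.
  transitivity (\sum_(i <- m) \sum_(j <- b)
      t i.2 * (alg_map T (j.1 i.1) * co p j.2)).
    rewrite big_seq [RHS]big_seq; apply: eq_bigr => i im.
    by rewrite {1}(bP i.1) ?co_sum ?mulr_sumr //; apply/ml/map_f.
  rewrite exchange_big; apply: eq_bigr => j _.
  rewrite -app_nat scalar_fun_map gP mulr_sumr; apply: eq_bigr => i _.
  by rewrite co_scalar_fun [RHS]mulrC mulrA.
apply: dual_eq => T t p; rewrite (E l) // ?(E l') //.
- by apply: eq_bigr => j _; rewrite hh'.
- by move=> c cl; rewrite mem_cat cl orbT.
- by move=> c cl; rewrite mem_cat cl.
Qed.

Variable s : alg_on F.

(** This is the comultiplication of C, obtained from the product alone. Multiplying by the universal
    functional [g] with values in k + C and reading the result at [c] is a functional of [p]; its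
    finite support gives the left factors, its coefficients the right ones. *)
Lemma dual_qc_comult (c : C) :
  exists l : seq (C * C), forall (S : calg k) (p q : F S),
    co (amul s p q) c = \sum_(i <- l) co p i.1 * co q i.2.
Proof.
pose T := @sqz_alg k (calg_base k) C.
have gL : linear (fun e : C => (0, e) : alg_mod T).
  move=> r e e'; congr pair; first by rewrite /= mulr0 addr0.
  by rewrite /= scale0r addr0.
pose g : F T := dual_of (linear_of gL).
pose phi (S : calg k) (t : calg_hom T S) (p : F S) : base k S :=
  co (amul s p (sf_map t g)) c.
have phiN (S U : calg k) (t : calg_hom T S) (u : calg_hom S U) p :
    phi U (calg_comp u t) (sf_map u p) = sf_map u (phi S t p).
  by rewrite /phi sf_map_comp -amap_mul co_map.
have phiD (S : calg k) (t : calg_hom T S) p q :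
    phi S t (madd (fm_mod F S) p q) =
    madd (fm_mod (base k) S) (phi S t p) (phi S t q).
  by rewrite /phi amulDl.
have phiZ (S : calg k) (t : calg_hom T S) a p :
    phi S t (mscale (fm_mod F S) a p) =
    mscale (fm_mod (base k) S) a (phi S t p).
  by rewrite /phi amulZl.
pose P : fdual F T := FModHomAt phiN phiD phiZ.
have PE (S : calg k) (t : calg_hom T S) (p : F S) :
    app (sf_map t P) p = co (amul s p (sf_map t g)) c.
  by rewrite -fmhE.
have [l lP] := dual_qc_support P.
(* A coefficient in T = k + C contributes its C component: the specialisation below sends [g] to eps
   q, and only the coefficient of eps is read. *)
exists [seq (i.1, i.2.2) | i <- l] => S p q; rewrite big_map /=.
pose D := sqz_alg (S : comPzRingType)^o.
pose j : calg_hom S D := sqz_inj _.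
pose f (e : C) : S^o := co q e.
have fD x y : f (x - y) = f x - f y by apply: (linearB (coL q)).
have fZ (a : calg_base k) x : f (a *: x) = calg_unit S a *: f x.
  exact: (linearZ_LR (coL q)).
pose h : calg_hom T D :=
  @sqz_map k (calg_base k) S C _ (calg_unit S) f fD fZ.
pose eps : D := (0, 1).
have hg : sf_map h g = mscale (fm_mod F D) eps (sf_map j q).
  apply: dual_qc_eq => e; rewrite co_map co_dual_of [RHS]/co app_scalel -/(co _ _).
  rewrite co_map; congr pair; first by rewrite /= rmorph0 mul0r.
  by rewrite /= scaler0 add0r [RHS]mulr1.
have := lP D h (sf_map j p).
rewrite PE hg amulZr -amap_mul [co _ _]app_scalel -/(co _ _) co_map.
move/(congr1 snd) => /=; rewrite scaler0 add0r => E.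
rewrite -[LHS]mulr1; apply: etrans E _.
elim: l {lP} => [|i l IHl]; first by rewrite !big_nil.
rewrite !big_cons -IHl; congr (_ + _).
by rewrite -[p D _ _]/(co (sf_map j p) i.1) co_map /= scaler0 add0r.
Qed.

End QcDualFunctionals.

(** * The ring of an algebra scheme over B and its quotients by vanishing ideals *)

Section DualRing.
Variables (k : comPzRingType) (C : lmodType k).
Local Notation F := (fdual (qc C)).
Variables (s : alg_on F) (sC : alg_commutative s) (B : calg k).

(** Linear maps from C to B are a small copy of the value of the dual at B, so they can carry a
    library ring structure. The phantom argument makes that structure depend on the product [s] and
    on its commutativity. *)
Definition dual_ring of alg_commutative s : Type := {linear C -> alg_mod B}.
Local Notation R := (dual_ring sC).
HB.instance Definition _ := gen_eqMixin R.
HB.instance Definition _ := gen_choiceMixin R.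

Definition to_ring (p : F B) : R := coL p.
Definition of_ring (f : R) : F B := dual_of (f : {linear C -> alg_mod B}).
Definition rcoef (f : R) (c : C) : B := (f : {linear C -> alg_mod B}) c.

Lemma co_of_ring (f : R) (c : C) : co (of_ring f) c = rcoef f c.
Proof. exact: co_dual_of. Qed.

Lemma to_ringK : cancel to_ring of_ring.
Proof. by move=> p; apply: dual_qc_eq => c; rewrite co_of_ring. Qed.

Lemma of_ringK : cancel of_ring to_ring.
Proof.
move=> f; have : coL (of_ring f) =1 (f : {linear C -> alg_mod B}).
  by move=> c; apply: co_of_ring.
rewrite /to_ring; move: (coL _) => g; case: g f => [g [[gA] [gZ]]] [f [[fA] [fZ]]].
move=> /funext /= gf; subst g.
by rewrite (Prop_irrelevance gA fA) (Prop_irrelevance gZ fZ).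
Qed.

Let m := fm_mod F B.
Let radd (f g : R) : R := to_ring (madd m (of_ring f) (of_ring g)).
Let ropp (f : R) : R := to_ring (mopp m (of_ring f)).
Let rzero : R := to_ring (mzero m).
Let rmul (f g : R) : R := to_ring (amul s (of_ring f) (of_ring g)).
Let rone : R := to_ring (aone s B).

Fact dual_ring_addA : associative radd.
Proof. by move=> f g h; rewrite /radd !to_ringK maddA. Qed.
Fact dual_ring_addC : commutative radd.
Proof. by move=> f g; rewrite /radd maddC. Qed.
Fact dual_ring_add0 : left_id rzero radd.
Proof. by move=> f; rewrite /radd to_ringK madd0 of_ringK. Qed.
Fact dual_ring_addN : left_inverse rzero ropp radd.
Proof. by move=> f; rewrite /radd to_ringK maddN. Qed.
HB.instance Definition _ := GRing.isZmodule.Build R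
  dual_ring_addA dual_ring_addC dual_ring_add0 dual_ring_addN.

Fact dual_ring_mulA : associative rmul.
Proof. by move=> f g h; rewrite /rmul !to_ringK amulA. Qed.
Fact dual_ring_mulC : commutative rmul.
Proof. by move=> f g; rewrite /rmul sC. Qed.
Fact dual_ring_mul1 : left_id rone rmul.
Proof. by move=> f; rewrite /rmul to_ringK amul1l of_ringK. Qed.
Fact dual_ring_mulDl : left_distributive rmul radd.
Proof. by move=> f g h; rewrite /rmul /radd !to_ringK amulDl. Qed.
HB.instance Definition _ := GRing.Zmodule_isComPzRing.Build R
  dual_ring_mulA dual_ring_mulC dual_ring_mul1 dual_ring_mulDl.

Lemma of_ringD (f g : R) : of_ring (f + g) = madd m (of_ring f) (of_ring g).
Proof. exact: to_ringK. Qed.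
Lemma of_ringM (f g : R) : of_ring (f * g) = amul s (of_ring f) (of_ring g).
Proof. exact: to_ringK. Qed.
Lemma of_ring1 : of_ring 1 = aone s B.
Proof. exact: to_ringK. Qed.
Lemma of_ring0 : of_ring 0 = mzero m.
Proof. exact: to_ringK. Qed.

Lemma to_ringM (p q : F B) : to_ring (amul s p q) = to_ring p * to_ring q.
Proof. by rewrite -[LHS]/(to_ring _) -(to_ringK p) -(to_ringK q) -of_ringM !of_ringK. Qed.

Definition rconst (b : B) : R := to_ring (mscale m b (aone s B)).

Lemma of_rconstM (b : B) (f : R) : of_ring (rconst b * f) = mscale m b (of_ring f).
Proof. by rewrite of_ringM to_ringK amulZl amul1l. Qed.

Lemma rcoefD (f g : R) (c : C) : rcoef (f + g) c = rcoef f c + rcoef g c.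
Proof. by rewrite -!co_of_ring of_ringD. Qed.

Lemma rcoefB (f g : R) (c : C) : rcoef (f - g) c = rcoef f c - rcoef g c.
Proof. by apply/eqP; rewrite eq_sym subr_eq -rcoefD subrK. Qed.

Lemma rcoefZ (b : B) (f : R) (c : C) : rcoef (rconst b * f) c = b * rcoef f c.
Proof. by rewrite -!co_of_ring of_rconstM. Qed.

Lemma rcoef_sum (I : Type) (r : seq I) (f : I -> R) (c : C) :
  rcoef (\sum_(i <- r) f i) c = \sum_(i <- r) rcoef (f i) c.
Proof.
elim: r => [|i r IHr]; first by rewrite !big_nil -co_of_ring of_ring0.
by rewrite !big_cons rcoefD IHr.
Qed.

Fact rconst_zmod : zmod_morphism rconst.
Proof.
move=> b b'; apply/eqP; rewrite eq_sym subr_eq; apply/eqP; apply: (can_inj of_ringK).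
by rewrite of_ringD !to_ringK -mscaleDl subrK.
Qed.
Fact rconst_monoid : monoid_morphism rconst.
Proof.
split=> [|b b']; apply: (can_inj of_ringK).
  by rewrite to_ringK mscale1 of_ring1.
by rewrite of_rconstM !to_ringK mscaleA.
Qed.

Section EvalRing.
Variables (S : calg k) (h : fspec (FAlgebra s) S) (t : calg_hom B S).

(** The ring morphism from C^*(B) to S that corresponds to the point [h]. *)
Definition ring_eval (f : R) : S := app (sp_lin h) (sf_map t (of_ring f)).

Fact ring_eval_zmod : zmod_morphism ring_eval.
Proof.
move=> f g; apply/eqP; rewrite eq_sym subr_eq; apply/eqP.
by rewrite /ring_eval -appD -fm_mapD -of_ringD subrK.
Qed.
Fact ring_eval_monoid : monoid_morphism ring_eval.
Proof.
split=> [|f g]; rewrite /ring_eval.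
  by rewrite of_ring1 (amap_one s); apply: spec1.
by rewrite of_ringM (amap_mul s); apply: specM.
Qed.
HB.instance Definition _ := GRing.isZmodMorphism.Build R S ring_eval ring_eval_zmod.
HB.instance Definition _ := GRing.isMonoidMorphism.Build R S ring_eval ring_eval_monoid.
End EvalRing.

(** The ideal generated by the functionals that vanish on [Y], as the intersection of the ideals
    containing them; these functionals need not form an ideal themselves. *)
Definition vanish_ideal (Y : seq C) (f : R) : Prop :=
  forall J : R -> Prop, ideal J ->
    (forall g, (forall y, y \in Y -> rcoef g y = 0) -> J g) -> J f.

Fact vanish_idealP (Y : seq C) : ideal (vanish_ideal Y).
Proof.
split=> [J [] //|f g fY gY J idJ YJ|f g gY J idJ YJ].
  by apply: (idealD idJ); [apply: fY | apply: gY].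
by apply: (idealM idJ); apply: gY.
Qed.

Lemma vanish_ideal_in (Y : seq C) (f : R) :
  (forall y, y \in Y -> rcoef f y = 0) -> vanish_ideal Y f.
Proof. by move=> fY J _; apply. Qed.

Definition vring (Y : seq C) : comPzRingType := idquot (vanish_idealP Y).
Definition vcl (Y : seq C) (f : R) : vring Y := idcl (vanish_idealP Y) f.
HB.instance Definition _ (Y : seq C) :=
  GRing.isZmodMorphism.Build R (vring Y) (vcl Y) (idcl_zmod _).
HB.instance Definition _ (Y : seq C) :=
  GRing.isMonoidMorphism.Build R (vring Y) (vcl Y) (idcl_monoid _).

Definition valg (Y : seq C) : calg k :=
  @CAlg k (vring Y) (vcl Y \o
    (rmorph_of rconst_zmod rconst_monoid \o alg_map B)).

Definition valg_in (Y : seq C) : calg_hom B (valg Y) :=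
  @CAlgHom k B (valg Y)
    (vcl Y \o rmorph_of rconst_zmod rconst_monoid)
    (fun=> erefl).
End DualRing.

(** * The universal point supported on a finite list *)

Section UniversalPoint.
Variables (k : comPzRingType) (C : lmodType k) (Cproj : projective C).
Local Notation F := (fdual (qc C)).
Variables (s : alg_on F) (sC : alg_commutative s) (B : calg k) (Y : seq C).
Local Notation R := (valg sC B Y).
Local Notation cl := (@vcl _ _ _ sC B Y).

Lemma vcl_eq (f g : dual_ring B sC) :
  (forall y, y \in Y -> rcoef f y = rcoef g y) -> cl f = cl g.
Proof.
move=> fg; apply/idclP; apply: vanish_ideal_in => y yY.
by rewrite rcoefB fg // subrr.
Qed.

Definition vbasis : seq ({linear C -> k^o} * C) :=
  sval (cid (dual_basis Y Cproj)).

Definition vscalar (phi : {linear C -> k^o}) : R :=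
  cl (to_ring sC (scalar_fun B phi)).

(** With a dual basis (phi_j, c_j) covering [Y], this is the element of C (x) R_Y equal to the sum
    of the c_j (x) [phi_j], regarded as a functional on C^*. *)
Definition vpoint_lin : fdual F R.
Proof.
unshelve refine (@FModHomAt k F (base k) R
  (fun S t p => \sum_(j <- vbasis) co p j.2 * t (vscalar j.1)) _ _ _).
- move=> S T t g p; cbv beta; rewrite [RHS]rmorph_sum; apply: eq_bigr => j _.
  by rewrite co_map [RHS]rmorphM.
- move=> S t p q; cbv beta; rewrite -[RHS]/(_ + _) -big_split; apply: eq_bigr => j _.
  by rewrite [co _ _]app_addl mulrDl.
- move=> S t a p; cbv beta; rewrite -[RHS]/(_ * _) mulr_sumr; apply: eq_bigr => j _.
  by rewrite [co _ _]app_scalel mulrA.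
Defined.

Lemma vpoint_appE (S : calg k) (t : calg_hom R S) (p : F S) :
  app (sf_map t vpoint_lin) p = \sum_(j <- vbasis) co p j.2 * t (vscalar j.1).
Proof. by rewrite -fmhE. Qed.

(** On [Y] the functional [p] agrees with the sum of the p(c_j) phi_j, so both have the same class:
    on functionals defined over B, the universal point is the quotient map. *)
Lemma vpoint_app (S : calg k) (t : calg_hom R S) (p : F B) :
  app (sf_map t vpoint_lin) (sf_map (calg_comp t (valg_in sC B Y)) p) =
  t (cl (to_ring sC p)).
Proof.
rewrite vpoint_appE.
transitivity (t (\sum_(j <- vbasis)
    cl (rconst sC (co p j.2) * to_ring sC (scalar_fun B j.1)))).
  rewrite rmorph_sum; apply: eq_bigr => j _.
  by rewrite co_map [in RHS]rmorphM rmorphM.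
congr (t _); rewrite -rmorph_sum; apply: vcl_eq => y yY.
rewrite rcoef_sum.
rewrite [in RHS](svalP (cid (dual_basis Y Cproj)) y yY).
rewrite [RHS]co_sum; apply: eq_bigr => j _.
by rewrite rcoefZ [rcoef _ _]co_scalar_fun mulrC.
Qed.

Lemma vpoint_app1 (p : F B) :
  app vpoint_lin (sf_map (valg_in sC B Y) p) = cl (to_ring sC p).
Proof.
have := vpoint_app (calg_id R) p.
by rewrite calg_comp1f (sf_map_id (s := fdual F)).
Qed.

Lemma vpoint_scalar (S : calg k) (t : calg_hom R S) phi :
  app (sf_map t vpoint_lin) (scalar_fun S phi) = t (vscalar phi).
Proof.
by rewrite -(scalar_fun_map (calg_comp t (valg_in sC B Y)) phi)
  vpoint_app.
Qed.

(** Scalar functionals separate, so multiplicativity is tested on them. They are defined over B,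
    where [vpoint_app] reduces the claim to multiplicativity of the quotient map. *)
Definition vpoint : fspec (FAlgebra s) R.
Proof.
exists vpoint_lin => S t.
- apply: (@dual_mult_sep k (FAlgebra s)
    (fun T f => exists phi, f = scalar_fun T phi)) => //.
  + by move=> U T u _ [phi ->]; exists phi; apply: scalar_fun_map.
  + move=> U p q pq; apply: (dual_qc_sep Cproj) => phi.
    have := pq U (calg_id U) (scalar_fun U phi).
    by rewrite !(sf_map_id (s := fdual F)); apply; exists phi.
  move=> T u _ _ [phi ->] [psi ->]; rewrite -(sf_map_comp (s := fdual F)).
  rewrite !vpoint_scalar -rmorphM -rmorphM.
  by rewrite -to_ringM -vpoint_app (amap_mul s) !scalar_fun_map.
- rewrite -[LHS]/(app _ (aone s S)) -(amap_one s (calg_comp t (valg_in sC B Y))).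
  by rewrite vpoint_app -(of_ring1 sC) of_ringK; exact: (rmorph1 t).
Defined.
End UniversalPoint.

(** * Gluing a function on the spectrum from its values at universal points *)

Section AlgScheme.
Variables (k : comPzRingType) (C : lmodType k) (Cproj : projective C).
Local Notation F := (fdual (qc C)).
Variables (s : alg_on F) (sC : alg_commutative s) (B : calg k).
Local Notation R := (dual_ring B sC).

(** Take for [Y] the left factors of the comultiple of [c]. *)
Lemma vanish_ideal_good (c : C) : exists Y : seq C,
  forall f : R, vanish_ideal Y f -> rcoef f c = 0.
Proof.
have [l lP] := dual_qc_comult s c.
exists [seq i.1 | i <- l] => f fY.
(* The f such that f g vanishes at [c] for every g form an ideal. It contains the functionals
   vanishing on [Y], and g = 1 gives the claim. *)
have J : ideal (fun f : R => forall g : R, rcoef (f * g) c = 0).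
  split=> [g|f1 f2 f1P f2P g|f1 f2 f2P g].
  - by rewrite mul0r -co_of_ring of_ring0.
  - by rewrite mulrDl rcoefD f1P f2P addr0.
  - by rewrite [f1 * f2]mulrC -mulrA f2P.
rewrite -[f]mulr1; apply: fY J _ 1 => g gY g'.
rewrite -co_of_ring of_ringM lP big_seq big1 // => i il.
by rewrite co_of_ring gY ?mul0r //; apply: map_f.
Qed.

Section Function.
Variable P : fun_at (fspec (FAlgebra s)) B.

(** A lift to C^*(B) of the value of [P] at the universal point of R_Y; only its class in R_Y is
    determined by [P]. *)
Definition vfun (Y : seq C) : R :=
  idrepr (P _ (valg_in sC B Y) (vpoint Cproj sC B Y) : valg sC B Y).

(** The hypothesis says that [h] is supported on [Y]. Such a point is the image of the universal
    point under a morphism from R_Y, and [P] is natural. *)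
Lemma vfunE (Y : seq C) (S : calg k) (t : calg_hom B S)
    (h : fspec (FAlgebra s) S) :
  (forall f : R, (forall y, y \in Y -> rcoef f y = 0) -> ring_eval h t f = 0) ->
  P S t h = ring_eval h t (vfun Y).
Proof.
move=> hY.
have hI (f : R) : vanish_ideal Y f -> ring_eval h t f = 0.
  move=> fY; apply: (fY (fun f => ring_eval h t f = 0)); last exact: hY.
  split=> [|x y x0 y0|x y y0]; first exact: rmorph0.
    by rewrite rmorphD /= x0 y0 addr0.
  by rewrite rmorphM /= y0 mulr0.
pose g := @idquot_lift _ _ (@vanish_idealP _ _ _ sC B Y) _
  (ring_eval h t : {rmorphism R -> S}).
have gcl f : g (vcl Y f) = ring_eval h t f by apply: idquot_lift_cl.
have gt b : g (valg_in sC B Y b) = t b.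
  rewrite gcl /ring_eval to_ringK fm_mapZ appZ (amap_one s) -[RHS]mulr1.
  by congr (_ * _); apply: (spec1 h).
have gE r : g (alg_map (valg sC B Y) r) = alg_map S r.
  by rewrite -(calg_funE t) -gt.
pose G : calg_hom (valg sC B Y) S :=
  @calg_hom_of k (valg sC B Y) S g
    (@idquot_lift_zmod _ _ (@vanish_idealP _ _ _ sC B Y) _ _ hI)
    (@idquot_lift_monoid _ _ (@vanish_idealP _ _ _ sC B Y) _ _ hI) gE.
have Gt : calg_comp G (valg_in sC B Y) = t by apply: calg_hom_eq.
(* The two points agree on scalar functionals, which suffices by [dual_qc_sep]. *)
have Gh : sf_map G (vpoint Cproj sC B Y) = h.
  apply: spec_at_eq; apply: (dual_qc_sep Cproj) => phi.
  rewrite [LHS]vpoint_scalar [LHS]gcl /ring_eval to_ringK.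
  by rewrite scalar_fun_map.
by rewrite -{1}Gt -{1}Gh fa_nat -[P _ _ _]idreprK [LHS]gcl.
Qed.

Definition vsupp (c : C) : seq C := sval (cid (vanish_ideal_good c)).

Lemma vsuppP (c : C) (f : R) : vanish_ideal (vsupp c) f -> rcoef f c = 0.
Proof. exact: (svalP (cid (vanish_ideal_good c))). Qed.

Definition glue (c : C) : alg_mod B := rcoef (vfun (vsupp c)) c.

(** The universal point for [vsupp c] is also supported on the larger list [Y], so [vfunE] shows
    that [vfun Y] and [vfun (vsupp c)] have the same class modulo the ideal of [vsupp c], whose
    elements vanish at [c]. *)
Lemma glueE (c : C) (Y : seq C) :
  {subset vsupp c <= Y} -> glue c = rcoef (vfun Y) c.
Proof.
move=> cY; apply/eqP; rewrite -subr_eq0 -rcoefB; apply/eqP/vsuppP.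
apply/(idclP (@vanish_idealP _ _ _ sC B (vsupp c))).
have ev f : ring_eval (vpoint Cproj sC B (vsupp c)) (valg_in sC B (vsupp c)) f =
    vcl (vsupp c) f.
  by rewrite /ring_eval [LHS]vpoint_app1 of_ringK.
rewrite [LHS]idreprK (vfunE (Y := Y)) ?ev // => f fY.
rewrite ev -(rmorph0 (@vcl _ _ _ sC B (vsupp c))).
by apply: vcl_eq => y /cY/fY ->; rewrite -co_of_ring of_ring0.
Qed.

Fact glue_linear : linear glue.
Proof.
(* Over one list large enough for all three vectors, [glue] is the single linear map [vfun Y]. *)
move=> r c c'; pose Y := vsupp (r *: c + c') ++ vsupp c ++ vsupp c'.
rewrite !(@glueE _ Y) => [|x|x|x]; rewrite ?mem_cat; try by move->; rewrite ?orbT.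
exact: (linearP (vfun Y : {linear C -> alg_mod B})).
Qed.

Lemma glue_fun (S : calg k) (t : calg_hom B S) (h : fspec (FAlgebra s) S) :
  P S t h = app (sp_lin h) (sf_map t (dual_of (linear_of glue_linear))).
Proof.
have [l lP] := dual_qc_support (sp_lin h).
have hE p : app (sp_lin h) p = \sum_(i <- l) i.2 * co p i.1.
  by have := lP S (calg_id S) p; rewrite (sf_map_id (s := fdual F)).
(* The elements i.1 make [h] supported on [Y]; the lists [vsupp i.1] make [vfun Y] agree with [glue]
   at those elements. *)
pose Y := flatten [seq i.1 :: vsupp i.1 | i <- l].
have lY i : i \in l -> {subset i.1 :: vsupp i.1 <= Y}.
  by move=> il x xi; apply/flattenP; exists (i.1 :: vsupp i.1) => //; apply: map_f.
rewrite (vfunE (Y := Y)); last first.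
  move=> f fY; rewrite /ring_eval hE big_seq big1 // => i il.
  by rewrite co_map co_of_ring fY ?rmorph0 ?mulr0 //; apply: (lY i il); rewrite mem_head.
rewrite /ring_eval !hE big_seq [RHS]big_seq; apply: eq_bigr => i il.
rewrite !co_map co_of_ring co_dual_of /= (@glueE _ Y) // => x xi.
by apply: (lY i il); rewrite inE xi orbT.
Qed.
End Function.

(** For each [c], compare both sides at the universal point of a list good for [c]: equal classes
    have equal values at [c]. *)
Lemma alg_scheme_inj (f f' : F B) :
  (forall (S : calg k) (t : calg_hom B S) (h : fspec (FAlgebra s) S),
     app (sp_lin h) (sf_map t f) = app (sp_lin h) (sf_map t f')) -> f = f'.
Proof.
move=> ff'; apply: dual_qc_eq => c; have [Y Yc] := vanish_ideal_good c.
have := ff' _ (valg_in sC B Y) (vpoint Cproj sC B Y).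
rewrite !vpoint_app1 => /idclP/Yc/eqP; rewrite rcoefB subr_eq0 => /eqP.
by [].
Qed.
End AlgScheme.

Lemma alg_scheme_affine (k : comPzRingType) (C : lmodType k)
    (s : alg_on (fdual (qc C))) :
  projective C -> alg_commutative s -> faffine (FAlgebra s).
Proof.
move=> Cproj sC B; split=> [P|f f']; last exact: (alg_scheme_inj Cproj sC).
by exists (dual_of (linear_of (glue_linear Cproj sC P))) => S t h; apply: glue_fun.
Qed.

(** * Convolution and biduality *)

Section BidualUnit.
Variables (k : comPzRingType) (X : fmonoid k).

Definition bidual_eval (B : calg k) (x : X B) : mdual (mdual X) B.
Proof.
unshelve refine (@FMonHomAt k (mdual X) (base_mon k) B
  (fun S s chi => fga_fun chi (calg_id S) (sf_map s x)) _ _ _) => //.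
move=> S T s g chi; rewrite [LHS]/= calg_comp1f sf_map_comp.
by rewrite -[RHS]fga_nat calg_compf1.
Defined.

Definition bidual_unit : fmon_hom X (mdual (mdual X)).
Proof.
unshelve refine (@FMonHom k X (mdual (mdual X))
  (@SNat k X (mdual (mdual X)) bidual_eval _) _ _).
- by move=> A B f x; apply: fmon_hom_at_eq => S s chi; rewrite /= sf_map_comp.
- by move=> B x y; apply: fmon_hom_at_eq => S s chi; rewrite /= fg_mapM fga_mul.
- by move=> B; apply: fmon_hom_at_eq => S s chi; rewrite /= fg_map1 fga_one.
Defined.
End BidualUnit.

Section Convolution.
Variables (k : comPzRingType) (X : fmonoid k) (F : falgebra k).
Hypotheses (Xab : abelian X) (FC : alg_commutative (fa_alg F)).
Hypotheses (Faff : faffine F) (Frefl : freflexive F).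
Variables (i : snat X (fspec F)) (j : snat (fspec F) X).
Hypotheses (ij : forall B, cancel (i B) (j B)) (ji : forall B, cancel (j B) (i B)).

(** The point mass at [x]; [ev x f] is then the value of the function [f] at [x]. *)
Definition delta (B : calg k) (x : X B) : fdual F B := sp_lin (i B x).
Definition ev (B : calg k) (x : X B) (f : F B) : B := app (delta x) f.

Lemma delta_map (A B : calg k) (g : calg_hom A B) (x : X A) :
  sf_map g (delta x) = delta (sf_map g x).
Proof. by rewrite /delta sn_nat. Qed.

Lemma ev_nat (A B : calg k) (g : calg_hom A B) (x : X A) (f : F A) :
  ev (sf_map g x) (sf_map g f) = g (ev x f).
Proof. by rewrite /ev -delta_map app_nat. Qed.

(** F(B) is the set of functions on X over B, so identities in it are checked at points of X over
    all B-algebras. The rules for translates and averages below come from this. *)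
Lemma ev_inj (B : calg k) (f f' : F B) :
  (forall (S : calg k) (s : calg_hom B S) (x : X S),
     ev x (sf_map s f) = ev x (sf_map s f')) -> f = f'.
Proof.
move=> ff'; apply: (proj2 (Faff B)) => S s h.
by rewrite -(ji h); apply: ff'.
Qed.

Fact frep_exists (B : calg k) (P : fun_at X B) : exists f : F B,
  forall (S : calg k) (s : calg_hom B S) (x : X S), P S s x = ev x (sf_map s f).
Proof.
have PN S T (s : calg_hom B S) (g : calg_hom S T) (h : fspec F S) :
    P T (calg_comp g s) (j T (sf_map g h)) = g (P S s (j S h)).
  by rewrite sn_nat fa_nat.
have [f fP] := proj1 (Faff B) (FunAt PN).
by exists f => S s x; rewrite -[RHS]fP /= ij.
Qed.

Definition frep (B : calg k) (P : fun_at X B) : F B := sval (cid (frep_exists P)).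

Lemma frepE (B : calg k) (P : fun_at X B) (S : calg k) (s : calg_hom B S) (x : X S) :
  ev x (sf_map s (frep P)) = P S s x.
Proof. by rewrite /frep; case: cid. Qed.

Lemma frepE1 (B : calg k) (P : fun_at X B) (x : X B) :
  ev x (frep P) = P B (calg_id B) x.
Proof. by rewrite -frepE sf_map_id. Qed.

Fact translate_nat (B : calg k) (x : X B) (f : F B) (S T : calg k)
    (s : calg_hom B S) (g : calg_hom S T) (y : X S) :
  ev (gmul (fg_mon X T) (sf_map (calg_comp g s) x) (sf_map g y))
     (sf_map (calg_comp g s) f) =
  g (ev (gmul (fg_mon X S) (sf_map s x) y) (sf_map s f)).
Proof. by rewrite !sf_map_comp -fg_mapM ev_nat. Qed.

(* The function y |-> f (x y). *)
Definition translate (B : calg k) (x : X B) (f : F B) : F B :=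
  frep (FunAt (translate_nat x f)).

Lemma ev_translate (B : calg k) (x y : X B) (f : F B) :
  ev y (translate x f) = ev (gmul (fg_mon X B) x y) f.
Proof. by rewrite frepE1 /= !sf_map_id. Qed.

Lemma translate_map (A B : calg k) (g : calg_hom A B) (x : X A) (f : F A) :
  sf_map g (translate x f) = translate (sf_map g x) (sf_map g f).
Proof.
apply: ev_inj => S s y; rewrite -sf_map_comp !frepE /=.
by rewrite !sf_map_comp.
Qed.

Lemma translate_add (B : calg k) (x : X B) (f f' : F B) :
  translate x (madd (fm_mod F B) f f') =
  madd (fm_mod F B) (translate x f) (translate x f').
Proof.
apply: ev_inj => S s y; rewrite fm_mapD /ev appD -!/(ev _ _).
by rewrite !translate_map !ev_translate fm_mapD /ev appD.
Qed.

Lemma translate_scale (B : calg k) (x : X B) (b : B) (f : F B) :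
  translate x (mscale (fm_mod F B) b f) = mscale (fm_mod F B) b (translate x f).
Proof.
apply: ev_inj => S s y; rewrite fm_mapZ /ev appZ -!/(ev _ _).
by rewrite !translate_map !ev_translate fm_mapZ /ev appZ.
Qed.

Lemma translate_comp (B : calg k) (x y : X B) (f : F B) :
  translate y (translate x f) = translate (gmul (fg_mon X B) x y) f.
Proof.
apply: ev_inj => S s z.
by rewrite !translate_map !ev_translate fg_mapM gmulA.
Qed.

Fact average_nat (B : calg k) (q : fdual F B) (f : F B) (S T : calg k)
    (s : calg_hom B S) (g : calg_hom S T) (x : X S) :
  app (sf_map (calg_comp g s) q)
    (translate (sf_map g x) (sf_map (calg_comp g s) f)) =
  g (app (sf_map s q) (translate x (sf_map s f))).
Proof. by rewrite !sf_map_comp -translate_map app_nat. Qed.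

(* The function x |-> q (y |-> f (x y)). *)
Definition average (B : calg k) (q : fdual F B) (f : F B) : F B :=
  frep (FunAt (average_nat q f)).

Lemma ev_average (B : calg k) (q : fdual F B) (x : X B) (f : F B) :
  ev x (average q f) = app q (translate x f).
Proof.
rewrite frepE1.
rewrite -[LHS]/(app (sf_map (calg_id B) q) (translate x (sf_map (calg_id B) f))).
by rewrite !sf_map_id.
Qed.

Lemma average_map (A B : calg k) (g : calg_hom A B) (q : fdual F A) (f : F A) :
  sf_map g (average q f) = average (sf_map g q) (sf_map g f).
Proof.
apply: ev_inj => S s x; rewrite -sf_map_comp !frepE.
rewrite -[LHS]/(app (sf_map (calg_comp s g) q) (translate x _)).
rewrite -[RHS]/(app (sf_map s (sf_map g q)) (translate x _)).
by rewrite !sf_map_comp.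
Qed.

Lemma average_add (B : calg k) (q : fdual F B) (f f' : F B) :
  average q (madd (fm_mod F B) f f') =
  madd (fm_mod F B) (average q f) (average q f').
Proof.
apply: ev_inj => S s x; rewrite fm_mapD /ev appD -!/(ev _ _).
by rewrite !average_map !ev_average fm_mapD translate_add appD.
Qed.

Lemma average_scale (B : calg k) (q : fdual F B) (b : B) (f : F B) :
  average q (mscale (fm_mod F B) b f) = mscale (fm_mod F B) b (average q f).
Proof.
apply: ev_inj => S s x; rewrite fm_mapZ /ev appZ -!/(ev _ _).
by rewrite !average_map !ev_average fm_mapZ translate_scale appZ.
Qed.

Lemma average_addl (B : calg k) (q q' : fdual F B) (f : F B) :
  average (madd (fm_mod (fdual F) B) q q') f =
  madd (fm_mod F B) (average q f) (average q' f).
Proof.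
apply: ev_inj => S s x; rewrite fm_mapD /ev appD -!/(ev _ _).
by rewrite !average_map !ev_average fm_mapD app_addl.
Qed.

Lemma average_scalel (B : calg k) (b : B) (q : fdual F B) (f : F B) :
  average (mscale (fm_mod (fdual F) B) b q) f = mscale (fm_mod F B) b (average q f).
Proof.
apply: ev_inj => S s x; rewrite fm_mapZ /ev appZ -!/(ev _ _).
by rewrite !average_map !ev_average fm_mapZ app_scalel.
Qed.

(** By associativity both sides are the function y |-> q(z |-> f(x y z)). *)
Lemma translate_average (B : calg k) (x : X B) (q : fdual F B) (f : F B) :
  translate x (average q f) = average q (translate x f).
Proof.
apply: ev_inj => S s y.
rewrite translate_map !average_map ev_translate !ev_average translate_map.
by rewrite translate_comp.
Qed.

(** At y the two sides are f(y x) and f(x y), equal because X is abelian. *)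
Lemma average_delta (B : calg k) (x : X B) (f : F B) :
  average (delta x) f = translate x f.
Proof.
apply: ev_inj => S s y; rewrite average_map translate_map delta_map ev_average.
by rewrite -/(ev _ _) !ev_translate Xab.
Qed.

Definition conv (B : calg k) (p q : fdual F B) : fdual F B.
Proof.
unshelve refine (@FModHomAt k F (base k) B
  (fun S s f => app (sf_map s p) (average (sf_map s q) f)) _ _ _).
- move=> S T s g f; cbv beta.
  by rewrite !(sf_map_comp (s := fdual F)) -average_map app_nat.
- by move=> S s f f'; cbv beta; rewrite average_add appD.
- by move=> S s a f; cbv beta; rewrite average_scale appZ.
Defined.

Lemma app_conv_map (B S : calg k) (s : calg_hom B S) (p q : fdual F B) (f : F S) :
  app (sf_map s (conv p q)) f = app (sf_map s p) (average (sf_map s q) f).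
Proof. by rewrite -fmhE. Qed.

Lemma app_conv (B : calg k) (p q : fdual F B) (f : F B) :
  app (conv p q) f = app p (average q f).
Proof.
by have := app_conv_map (calg_id B) p q f; rewrite !(sf_map_id (s := fdual F)).
Qed.

Lemma conv_map (A B : calg k) (g : calg_hom A B) (p q : fdual F A) :
  sf_map g (conv p q) = conv (sf_map g p) (sf_map g q).
Proof.
apply: dual_eq => S s f.
by rewrite -(sf_map_comp (s := fdual F)) !app_conv_map
  !(sf_map_comp (s := fdual F)).
Qed.

Lemma average_conv (B : calg k) (p q : fdual F B) (f : F B) :
  average (conv p q) f = average p (average q f).
Proof.
apply: ev_inj => S s x; rewrite !average_map conv_map !ev_average app_conv.
by rewrite translate_average.
Qed.

Lemma average_one (B : calg k) (f : F B) :
  average (delta (gone (fg_mon X B))) f = f.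
Proof.
apply: ev_inj => S s x; rewrite average_map delta_map fg_map1 ev_average.
by rewrite -/(ev _ _) ev_translate gmul1r.
Qed.

(* Fubini: both iterated integrals of f (x y), as functionals of p, are given
   by evaluation at an element of F, so they need only be compared at the point
   masses p = delta x. *)
Lemma convC (B : calg k) : commutative (@conv B).
Proof.
suff E (S : calg k) (p q : fdual F S) f : app p (average q f) = app q (average p f).
  move=> p q; apply: dual_eq => S s f.
  by rewrite !conv_map !app_conv.
pose phi (T : calg k) (t : calg_hom S T) (r : fdual F T) : base k T :=
  app (sf_map t q) (average r (sf_map t f)).
have phiN T U (t : calg_hom S T) (g : calg_hom T U) r :
    phi U (calg_comp g t) (sf_map g r) = sf_map g (phi T t r).
  by rewrite /phi !sf_map_comp -average_map app_nat.
have phiD T (t : calg_hom S T) r r' :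
    phi T t (madd (fm_mod (fdual F) T) r r') =
    madd (fm_mod (base k) T) (phi T t r) (phi T t r').
  by rewrite /phi average_addl appD.
have phiZ T (t : calg_hom S T) a r :
    phi T t (mscale (fm_mod (fdual F) T) a r) =
    mscale (fm_mod (base k) T) a (phi T t r).
  by rewrite /phi average_scalel appZ.
have [f' f'P] := proj1 (Frefl S) (FModHomAt phiN phiD phiZ).
have {}f'P T (t : calg_hom S T) r : app r (sf_map t f') = phi T t r.
  by rewrite -f'P -fmhE.
have ff' : f' = average q f.
  apply: ev_inj => T t x; rewrite /ev f'P /phi average_delta average_map.
  by rewrite -/(ev _ _) ev_average.
by rewrite -ff'; have := f'P S (calg_id S) p; rewrite /phi !sf_map_id.
Qed.

Definition conv_alg : alg_on (fdual F).
Proof.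
unshelve refine (@AlgOn k (fdual F) conv (fun B => delta (gone (fg_mon X B)))
  _ _ _ _ _ _ _ _ _).
- move=> B p q r; apply: dual_eq => S s f.
  by rewrite !conv_map !app_conv average_conv.
- move=> B p; apply: dual_eq => S s f.
  by rewrite convC !conv_map app_conv delta_map fg_map1 average_one.
- move=> B p; apply: dual_eq => S s f.
  by rewrite !conv_map app_conv delta_map fg_map1 average_one.
- move=> B p q r; apply: dual_eq => S s f.
  by rewrite fm_mapD !conv_map fm_mapD app_addl !app_conv.
- move=> B p q r; apply: dual_eq => S s f.
  by rewrite fm_mapD !conv_map fm_mapD app_addl !app_conv average_addl appD.
- move=> B b p q; apply: dual_eq => S s f.
  by rewrite fm_mapZ !conv_map fm_mapZ app_scalel !app_conv.
- move=> B b p q; apply: dual_eq => S s f.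
  by rewrite fm_mapZ !conv_map fm_mapZ app_scalel !app_conv average_scalel appZ.
- by move=> A B f p q; apply: conv_map.
- by move=> A B f; rewrite delta_map fg_map1.
Defined.

Definition dual_alg : falgebra k := FAlgebra conv_alg.

Lemma ev_one (B : calg k) (x : X B) : ev x (aone (fa_alg F) B) = 1.
Proof. exact: spec1. Qed.

Lemma ev_mul (B : calg k) (x : X B) (f g : F B) :
  ev x (amul (fa_alg F) f g) = ev x f * ev x g.
Proof. exact: specM. Qed.

(** * Characters as points of the spectrum of the convolution algebra *)

Fact char_nat (B : calg k) (chi : mdual X B) (S T : calg k)
    (s : calg_hom B S) (g : calg_hom S T) (x : X S) :
  fga_fun chi (calg_comp g s) (sf_map g x) = g (fga_fun chi s x).
Proof. exact: fga_nat. Qed.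

Definition char_rep (B : calg k) (chi : mdual X B) : F B :=
  frep (FunAt (char_nat chi)).

Lemma ev_char (B S : calg k) (chi : mdual X B) (s : calg_hom B S) (x : X S) :
  ev x (sf_map s (char_rep chi)) = fga_fun chi s x.
Proof. exact: frepE. Qed.

Lemma char_rep_map (A B : calg k) (g : calg_hom A B) (chi : mdual X A) :
  char_rep (sf_map g chi) = sf_map g (char_rep chi).
Proof.
by apply: ev_inj => S s x; rewrite ev_char -sf_map_comp ev_char.
Qed.

Lemma char_repM (B : calg k) (chi chi' : mdual X B) :
  char_rep (gmul (fg_mon (mdual X) B) chi chi') =
  amul (fa_alg F) (char_rep chi) (char_rep chi').
Proof.
by apply: ev_inj => S s x; rewrite amap_mul ev_mul !ev_char.
Qed.

Lemma char_rep1 (B : calg k) :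
  char_rep (gone (fg_mon (mdual X) B)) = aone (fa_alg F) B.
Proof. by apply: ev_inj => S s x; rewrite amap_one ev_one ev_char. Qed.

(** The translate of a character chi by x is chi(x) chi, so averaging against [q] multiplies chi by
    q(chi). *)
Lemma average_char (B : calg k) (chi : mdual X B) (q : fdual F B) :
  average q (char_rep chi) = mscale (fm_mod F B) (app q (char_rep chi)) (char_rep chi).
Proof.
apply: ev_inj => S s x.
rewrite average_map ev_average fm_mapZ /ev appZ -/(ev _ _) -app_nat.
rewrite mulrC ev_char -[fga_fun chi s x]/(fga_fun chi s x : S) -appZ; congr app.
apply: ev_inj => T t y; rewrite translate_map ev_translate -sf_map_comp ev_char.
rewrite fm_mapZ /ev appZ -/(ev _ _) -sf_map_comp ev_char fga_mul /=.
congr (_ * _); first exact: (fga_nat chi).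
Qed.

Fact app_eval_char (B S : calg k) (s : calg_hom B S) (chi : mdual X B) (p : fdual F S) :
  app (sf_map s (eval_dual (char_rep chi))) p = app p (char_rep (sf_map s chi)).
Proof. by rewrite eval_dual_map app_eval_dual char_rep_map. Qed.

(** Evaluation at a character chi is multiplicative for convolution: p applied to q(chi) chi is
    p(chi) q(chi). *)
Definition char_point (B : calg k) (chi : mdual X B) : fspec dual_alg B.
Proof.
exists (eval_dual (char_rep chi)) => S s.
- by move=> p q; rewrite !app_eval_char [LHS]app_conv average_char appZ mulrC.
- by rewrite app_eval_char -[LHS]/(ev _ _) -[char_rep _]sf_map_id ev_char fga_one.
Defined.

Lemma app_char_point (B : calg k) (chi : mdual X B) (p : fdual F B) :
  app (sp_lin (char_point chi)) p = app p (char_rep chi).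
Proof. exact: (app_eval_dual (char_rep chi) p). Qed.

Fact char_point_nat (A B : calg k) (g : calg_hom A B) (chi : mdual X A) :
  char_point (sf_map g chi) = sf_map g (char_point chi).
Proof.
apply: spec_at_eq; rewrite [RHS]eval_dual_map; congr eval_dual.
exact: char_rep_map.
Qed.

Definition char_point_snat : snat (mdual X) (fspec dual_alg) := SNat char_point_nat.

Lemma char_point_inj (B : calg k) : injective (@char_point B).
Proof.
move=> chi chi' e; apply: fmon_hom_at_eq => S s x; rewrite -!ev_char.
have := congr1 (fun h : fspec dual_alg B => app (sf_map s (sp_lin h)) (delta x)) e.
by rewrite !app_eval_char !char_rep_map.
Qed.

(** The character is x |-> h(delta x), multiplicative because point masses convolve to the point
    mass of the product. *)
Lemma char_point_surj (B : calg k) (h : fspec dual_alg B) :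
  exists chi, char_point chi = h.
Proof.
unshelve eexists (@FMonHomAt k X (base_mon k) B
  (fun S s x => app (sf_map s (sp_lin h)) (delta x)) _ _ _).
- move=> S T s g x; cbv beta.
  by rewrite (sf_map_comp (s := fdual dual_alg)) -delta_map app_nat.
- move=> S s x y; cbv beta; rewrite -[RHS]sp_mul; congr app.
  apply: dual_eq => T t f; rewrite [sf_map t (amul _ _ _)]conv_map.
  rewrite !delta_map [RHS]app_conv average_delta -![app _ _]/(ev _ _).
  by rewrite ev_translate fg_mapM Xab.
- by move=> S s; apply: (sp_one h).
(* By reflexivity [h] is evaluation at some [f], which agrees with the character at every point mass
   and hence represents it. *)
have [f fP] := proj1 (Frefl B) (sp_lin h).
apply: spec_at_eq; apply: dual_eq => S s p; rewrite fP eval_dual_map app_eval_dual.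
congr (app p (sf_map s _)); apply: ev_inj => T t x.
by rewrite ev_char; apply: fP.
Qed.

Lemma mdual_spec : siso (mdual X) (fspec dual_alg).
Proof.
exact: (siso_bij (u := char_point_snat) char_point_inj char_point_surj).
Qed.

(** * Biduality *)

Hypothesis dual_affine : faffine dual_alg.

(** Elements of F^* are functions on its spectrum, and the points of that spectrum are the
    characters. *)
Lemma char_sep (B : calg k) (p q : fdual F B) :
  (forall (S : calg k) (s : calg_hom B S) (chi : mdual X S),
     app (sf_map s p) (char_rep chi) = app (sf_map s q) (char_rep chi)) -> p = q.
Proof.
move=> pq; apply: (proj2 (dual_affine B)) => S s h.
by have [chi <-] := char_point_surj h; rewrite !app_char_point; apply: pq.
Qed.

(** Points with the same image have point masses that agree on all characters, so [char_sep]
    applies. *)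
Lemma bidual_unit_inj (B : calg k) : injective (@bidual_eval k X B).
Proof.
move=> x y exy; apply: (can_inj (@ij B)); apply: spec_at_eq.
apply: char_sep => S s chi; rewrite -/(delta _) -/(delta _) !delta_map.
have := congr1 (fun w => fga_fun w s chi) exy => /=.
by rewrite -!ev_char sf_map_id.
Qed.

Lemma bidual_unit_surj (B : calg k) (w : mdual (mdual X) B) :
  exists x, bidual_eval x = w.
Proof.
(* Through the bijection between characters and points, [w] becomes a function on the spectrum of
   F^*, that is, an element [p] of F^*. *)
have [u [ku uk]] := snat_inverse (u := char_point_snat) char_point_inj char_point_surj.
have wN S T (s : calg_hom B S) (g : calg_hom S T) (h : fspec dual_alg S) :
    fga_fun w (calg_comp g s) (u T (sf_map g h)) = g (fga_fun w s (u S h)).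
  by rewrite sn_nat; apply: fga_nat.
have [p pP] := proj1 (dual_affine B) (FunAt wN).
have {}pP S (s : calg_hom B S) (chi : mdual X S) :
    app (sf_map s p) (char_rep chi) = fga_fun w s chi.
  by rewrite -app_char_point -[RHS](congr1 _ (ku S chi)) -pP.
(* On characters [p] is multiplicative because [w] is; since characters separate functionals,
   [dual_mult_sep] extends this to all of F, and [p] is a point of X. *)
pose K (S : calg k) (f : F S) := exists chi : mdual X S, f = char_rep chi.
have pM S (s : calg_hom B S) f g :
    app (sf_map s p) (amul (fa_alg F) f g) = app (sf_map s p) f * app (sf_map s p) g.
  apply: (dual_mult_sep (K := K)) => //.
  - by move=> T U t _ [chi ->]; exists (sf_map t chi); rewrite char_rep_map.
  - by move=> T q r qr; apply: char_sep => U t chi; apply: qr; exists chi.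
  move=> T t _ _ [chi ->] [chi' ->].
  by rewrite -char_repM -(sf_map_comp (s := fdual F)) !pP fga_mul.
have p1 S (s : calg_hom B S) : app (sf_map s p) (aone (fa_alg F) S) = 1.
  by rewrite -char_rep1 pP; apply: (fga_one w).
exists (j B (@SpecAt k F B p pM p1)); apply: fmon_hom_at_eq => S s chi /=.
rewrite -ev_char sf_map_id -pP /ev -delta_map.
by rewrite /delta ji.
Qed.
End Convolution.

(** * Transport to the two categories *)

Section FalgebraIso.
Variable k : comPzRingType.

Section Pull.
Variables (F G : falgebra k) (u : falg_hom F G).

Definition spec_pull (B : calg k) (h : fspec G B) : fspec F B.
Proof.
unshelve eexists (@FModHomAt k F (base k) B
  (fun S s f => app (sf_map s (sp_lin h)) (fah_nat u S f)) _ _ _).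
- move=> S T s g f; cbv beta.
  by rewrite sn_nat (sf_map_comp (s := fdual G)) app_nat.
- by move=> S s f f'; cbv beta; rewrite fah_add appD.
- by move=> S s a f; cbv beta; rewrite fah_scale appZ.
- by move=> S s f g; rewrite -!fmhE [LHS]/= fah_mul; apply: (sp_mul h).
- by move=> S s; rewrite -!fmhE [LHS]/= fah_one; apply: (sp_one h).
Defined.

Lemma app_spec_pull_map (B S : calg k) (s : calg_hom B S) (h : fspec G B) (f : F S) :
  app (sf_map s (sp_lin (spec_pull h))) f = app (sf_map s (sp_lin h)) (fah_nat u S f).
Proof. by rewrite -fmhE. Qed.

Lemma app_spec_pull (B : calg k) (h : fspec G B) (f : F B) :
  app (sp_lin (spec_pull h)) f = app (sp_lin h) (fah_nat u B f).
Proof.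
by have := app_spec_pull_map (calg_id B) h f; rewrite !sf_map_id.
Qed.

Fact spec_pull_nat (A B : calg k) (g : calg_hom A B) (h : fspec G A) :
  spec_pull (sf_map g h) = sf_map g (spec_pull h).
Proof.
apply: spec_at_eq; apply: dual_eq => S s f; rewrite -!fmhE [LHS]/=.
by rewrite -calg_compA.
Qed.
End Pull.

Variables (F G : falgebra k) (u : falg_hom F G).
Hypothesis uI : forall B, injective (fah_nat u B).
Hypothesis uS : forall B y, exists x, fah_nat u B x = y.

Lemma falg_inverse : exists v : falg_hom G F,
  (forall B, cancel (fah_nat u B) (fah_nat v B)) /\
  (forall B, cancel (fah_nat v B) (fah_nat u B)).
Proof.
have [v [uK vK]] := snat_inverse uI uS.
unshelve eexists (@FAlgHom k G F v _ _ _ _) => //.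
- by move=> B x y; apply: uI; rewrite fah_add !vK.
- by move=> B b x; apply: uI; rewrite fah_scale !vK.
- by move=> B x y; apply: uI; rewrite fah_mul !vK.
- by move=> B; apply: uI; rewrite fah_one !vK.
Qed.

Lemma spec_pullK (v : falg_hom G F) :
  (forall B, cancel (fah_nat v B) (fah_nat u B)) ->
  forall B, cancel (@spec_pull F G u B) (@spec_pull G F v B).
Proof.
move=> vK B h; apply: spec_at_eq; apply: dual_eq => S s f.
by rewrite !app_spec_pull_map vK.
Qed.
End FalgebraIso.

Section FalgebraIsoAffine.
Variables (k : comPzRingType) (F G : falgebra k) (u : falg_hom F G).
Hypothesis uI : forall B, injective (fah_nat u B).
Hypothesis uS : forall B y, exists x, fah_nat u B x = y.

Lemma fspec_iso : siso (fspec G) (fspec F).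
Proof.
have [v [uK vK]] := falg_inverse uI uS.
exists (SNat (spec_pull_nat u)), (SNat (spec_pull_nat v)).
by split; apply: spec_pullK.
Qed.

Lemma faffine_iso : faffine F -> faffine G.
Proof.
have [v [uK vK]] := falg_inverse uI uS.
move=> Faff B; split=> [P|f f' ff'].
  have PN S T (s : calg_hom B S) (g : calg_hom S T) (h : fspec F S) :
      P T (calg_comp g s) (spec_pull v (sf_map g h)) = g (P S s (spec_pull v h)).
    by rewrite spec_pull_nat fa_nat.
  have [f fP] := proj1 (Faff B) (FunAt PN).
  exists (fah_nat u B f) => S s h.
  by rewrite -sn_nat -app_spec_pull -fP /= spec_pullK.
apply: (can_inj (vK B)); apply: (proj2 (Faff B)) => S s h.
by rewrite -!sn_nat -!app_spec_pull ff'.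
Qed.
End FalgebraIsoAffine.

(** * Algebra structures transported along an isomorphism with C (x) - *)

Record ring_transport (k : comPzRingType) (C : lmodType k) (Q : falgebra k) :=
RingTransport {
  rt_fun : C -> Q (calg_base k);
  rt_inv : Q (calg_base k) -> C;
  rt_funK : cancel rt_fun rt_inv;
  rt_invK : cancel rt_inv rt_fun;
  rt_add : forall c d, rt_fun (c + d) = madd (fm_mod Q _) (rt_fun c) (rt_fun d);
  rt_scale : forall (r : k) c,
    rt_fun (r *: c) = mscale (fm_mod Q (calg_base k)) r (rt_fun c);
  rt_comm : alg_commutative (fa_alg Q)
}.

Section TransportedRing.
Variables (k : comPzRingType) (C : lmodType k) (Q : falgebra k).
Variable t : ring_transport C Q.

(** The product of Q(k) is moved to C because C is small enough for a library ring; the phantom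
    argument records along which bijection. *)
Definition tring of ring_transport C Q : Type := C.
Local Notation R := (tring t).
HB.instance Definition _ := GRing.Zmodule.on R.

Let mul (c d : R) : R := rt_inv t (amul (fa_alg Q) (rt_fun t c) (rt_fun t d)).
Let one : R := rt_inv t (aone (fa_alg Q) (calg_base k)).

Fact tring_mulA : associative mul.
Proof. by move=> a b c; rewrite /mul !rt_invK amulA. Qed.
Fact tring_mulC : commutative mul.
Proof. by move=> a b; congr (rt_inv t _); apply: (rt_comm t). Qed.
Fact tring_mul1 : left_id one mul.
Proof. by move=> a; rewrite /mul rt_invK amul1l rt_funK. Qed.
Fact tring_mulDl : left_distributive mul +%R.
Proof.
move=> a b c; apply: (can_inj (rt_funK t)).
by rewrite [RHS]rt_add /mul !rt_invK [rt_fun t (a + b)]rt_add amulDl.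
Qed.
HB.instance Definition _ := GRing.Zmodule_isComPzRing.Build R
  tring_mulA tring_mulC tring_mul1 tring_mulDl.

Lemma rt_funM (c d : R) :
  rt_fun t (c * d) = amul (fa_alg Q) (rt_fun t c) (rt_fun t d).
Proof. exact: rt_invK. Qed.

Lemma rt_fun1 : rt_fun t (1 : R) = aone (fa_alg Q) (calg_base k).
Proof. exact: rt_invK. Qed.

Definition tring_const (r : k) : R := r *: (one : C).

Lemma tring_constM (r : k) (c : R) : tring_const r * c = (r *: (c : C)) :> C.
Proof.
apply: (can_inj (rt_funK t)); rewrite rt_funM !rt_scale amulZl.
by rewrite rt_invK amul1l.
Qed.

Fact tring_const_zmod : zmod_morphism tring_const.
Proof. by move=> r r'; apply: scalerBl. Qed.
Fact tring_const_monoid : monoid_morphism tring_const.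
Proof.
split=> [|r r']; first exact: scale1r.
by rewrite [RHS]tring_constM scalerA.
Qed.

Definition talg : calg k :=
  @CAlg k R (rmorph_of tring_const_zmod tring_const_monoid).

Fact tring_in_linear : linear (fun c : C => c : alg_mod talg).
Proof. by move=> r c d; rewrite alg_scaleE /= tring_constM. Qed.
Fact tring_out_linear : linear (fun c : alg_mod talg => c : C).
Proof. by move=> r c d; rewrite alg_scaleE /= tring_constM. Qed.

Lemma talg_projective : projective C -> projective (alg_mod talg).
Proof.
move=> Cproj M N g f gS.
have [h hP] := Cproj M N g (f \o linear_of tring_in_linear) gS.
by exists (h \o linear_of tring_out_linear) => x; apply: hP.
Qed.
End TransportedRing.

Section TransportQc.
Variables (k : comPzRingType) (C : lmodType k) (Q : falgebra k).
Hypothesis QC : alg_commutative (fa_alg Q).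
Variable theta : snat (qc C) Q.
Hypothesis thetaD : forall B (x y : tensor C B),
  theta B (x + y) = madd (fm_mod Q B) (theta B x) (theta B y).
Hypothesis thetaZ : forall (B : calg k) (b : B) (x : tensor C B),
  theta B (b *: x) = mscale (fm_mod Q B) b (theta B x).
Hypothesis thetaI : forall B, injective (theta B).
Hypothesis thetaS : forall B y, exists x, theta B x = y.

(** Since C (x) k is C, the bijection [theta] over k identifies C with Q(k) and gives it a product;
    Q is then recovered from Q(k) by base change. *)
Lemma qc_calg : exists A : calg k,
  (projective C -> projective (alg_mod A)) /\
  exists u : falg_hom (qc_alg A) Q,
    (forall B, injective (fah_nat u B)) /\
    (forall B y, exists x, fah_nat u B x = y).
Proof.
pose k0 := calg_base k.
pose iota (c : C) : Q k0 := theta k0 (pure c 1).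
have iotaD c d : iota (c + d) = madd (fm_mod Q k0) (iota c) (iota d).
  by rewrite /iota pureDl thetaD.
have iotaZ (r : k) c : iota (r *: c) = mscale (fm_mod Q k0) r (iota c).
  by rewrite /iota pureZ -thetaZ tensZ_pure.
have pure_base (x : tensor C k0) : exists c, pure c 1 = x.
  move: x; apply: tens_ind => [|x y [c <-] [d <-]|c r].
  - by exists 0; rewrite pure0l.
  - by exists (c + d); rewrite pureDl.
  - by exists ((r : k) *: c); rewrite pureZ /= mulr1.
(* The contraction from C (x) k to C shows that c |-> c (x) 1 is injective. *)
have kbal : balanced (fun (c : C) (r : k0) => (r : k) *: c).
  split=> [c d r|c r r'|r c r'|r]; first exact: scalerDr.
  - exact: scalerDl.
  - by rewrite scalerA mulrC.
  - exact: scaler0.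
have iotaI : injective iota.
  move=> c d /thetaI cd; rewrite -[c]scale1r -[d]scale1r.
  by rewrite -(tens_lift_pure kbal c 1) cd (tens_lift_pure kbal).
have iotaS q : exists c, iota c = q.
  have [x <-] := thetaS q; have [c <-] := pure_base x.
  by exists c.
have [rho [iotaK rhoK]] := sig_bij iotaI iotaS.
pose t := RingTransport iotaK rhoK iotaD iotaZ QC.
pose A := talg t; exists A; split; first exact: talg_projective.
(* [phi] and [psi] are both the identity of C, read as linear maps between C and the module
   underlying A. *)
pose phi := linear_of (@tring_out_linear k C Q t).
pose psi := linear_of (@tring_in_linear k C Q t).
pose w (B : calg k) (x : qc_alg A B) : Q B := theta B (tens_map phi (calg_id B) x).
have wN (S T : calg k) (g : calg_hom S T) x : w T (sf_map g x) = sf_map g (w S x).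
  rewrite /w -sn_nat; congr (theta T _); move: x.
  apply: tens_ind => [|x y IHx IHy|a b]; rewrite /=.
  - by rewrite !tens_map0.
  - by rewrite !tens_mapD IHx IHy.
  - by rewrite !tens_map_pure.
(* On pure tensors [w] is expressed through [iota], so multiplicativity over B reduces to the
   product transported to C. *)
have w_pure (B : calg k) (c : alg_mod A) (b : B) :
    w B (pure c b) = mscale (fm_mod Q B) b (sf_map (calg_unit B) (iota c)).
  rewrite /w tens_map_pure /= -[b in LHS]mulr1 -tensZ_pure thetaZ; congr mscale.
  by rewrite /iota -sn_nat [sf_map _ _]tens_map_pure rmorph1.
have wD (B : calg k) x y : w B (x + y) = madd (fm_mod Q B) (w B x) (w B y).
  by rewrite /w tens_mapD thetaD.
have wZ (B : calg k) (b : B) x : w B (b *: x) = mscale (fm_mod Q B) b (w B x).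
  by rewrite /w tens_mapZ thetaZ.
have w0 (B : calg k) : w B 0 = mscale (fm_mod Q B) 0 (w B 0).
  by rewrite -wZ scaler0.
have wM (B : calg k) (x y : tensor (alg_mod A) B) :
    w B (x * y) = amul (fa_alg Q) (w B x) (w B y).
  move: x; apply: tens_ind => [|x x' IHx IHx'|a b].
  - by rewrite mul0r w0 amulZl !mscale0l.
  - by rewrite mulrDl !wD IHx IHx' amulDl.
  move: y; apply: tens_ind => [|y y' IHy IHy'|a' b'].
  - by rewrite mulr0 w0 amulZr !mscale0l.
  - by rewrite mulrDr !wD IHy IHy' amulDr.
  rewrite tensM_pure !w_pure amulZl amulZr mscaleA -amap_mul.
  congr (mscale _ _ (sf_map _ _)).
  exact: (@rt_funM k C Q t a a').
have w1 (B : calg k) : w B 1 = aone (fa_alg Q) B.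
  rewrite [w _ _]w_pure mscale1 -(amap_one (fa_alg Q) (calg_unit B)).
  by congr (sf_map _ _); apply: (@rt_fun1 k C Q t).
exists (@FAlgHom k (qc_alg A) Q (@SNat k (qc_alg A) Q w wN) wD wZ wM w1).
split=> B /=.
  apply: inj_comp; first exact: thetaI.
  apply: (can_inj (g := tens_map psi (calg_id B))).
  by apply: tens_ind => [|x y IHx IHy|a b];
    rewrite ?tens_map0 // ?tens_mapD ?IHx ?IHy // !tens_map_pure.
move=> q; have [x <-] := thetaS q; exists (tens_map psi (calg_id B) x).
rewrite /w; congr (theta B _); move: x.
by apply: tens_ind => [|x y IHx IHy|a b];
  rewrite ?tens_map0 // ?tens_mapD ?IHx ?IHy // !tens_map_pure.
Qed.
End TransportQc.

Lemma eval_dual_bij (k : comPzRingType) (N : fmodule k) (B : calg k) :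
  freflexive N -> injective (@eval_dual k N B) /\
  (forall P, exists f, @eval_dual k N B f = P).
Proof.
move=> Nr; split=> [f f' ff'|P].
  apply: (proj2 (Nr B)) => S s p.
  by rewrite -[LHS]app_eval_dual -eval_dual_map ff' eval_dual_map app_eval_dual.
have [f fP] := proj1 (Nr B) P; exists f; apply: dual_eq => S s p.
by rewrite eval_dual_map app_eval_dual fP.
Qed.

(** * Exchange of the two kinds of monoids *)

Section Duality.
Variable k : comPzRingType.

Lemma mdual_abelian (X : fmonoid k) : abelian (mdual X).
Proof.
by move=> B u v; apply: fmon_hom_at_eq => S s x; apply: mulrC.
Qed.

(** Here F = A (x) -, affine by Yoneda and reflexive. Convolution is an algebra structure on its
    dual, an algebra scheme with C = A, so [alg_scheme_affine] supplies the affineness of the dual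
    that biduality requires. *)
Lemma affine_dual (G : FMon k) : affine_monoid G ->
  alg_scheme_monoid (mdual G) /\
  forall B, injective (@bidual_eval k G B) /\
    forall w, exists x, @bidual_eval k G B x = w.
Proof.
move=> [Gab [A [Aproj GA]]].
have [i [j [ij ji]]] := siso_trans GA (spec_fspec (qc_alg A)).
have AC : alg_commutative (fa_alg (qc_alg A)) by move=> B; apply: mulrC.
have Aaff := @qc_alg_affine k A.
have Arefl : freflexive (qc_alg A) by apply: qc_reflexive.
pose D := conv_alg Gab Aaff Arefl ij ji.
have DC : alg_commutative D by apply: convC.
have Daff : faffine (FAlgebra D) by apply: alg_scheme_affine.
split; last by move=> B; split;
  [exact: bidual_unit_inj Daff _ | exact: (bidual_unit_surj AC Daff)].
split; first exact: mdual_abelian.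
exists (alg_mod A), D; split=> //.
exact: siso_trans (mdual_spec Gab Aaff Arefl ij ji) (siso_sym (spec_fspec _)).
Qed.

(** Here F = C^*, so convolution lives on C^**, which is C (x) - by reflexivity. [qc_calg] makes
    this an algebra A with underlying module C, and the affineness of the dual is Yoneda for A. *)
Lemma alg_scheme_dual (H : FMon k) : alg_scheme_monoid H ->
  affine_monoid (mdual H) /\
  forall B, injective (@bidual_eval k H B) /\
    forall w, exists x, @bidual_eval k H B x = w.
Proof.
move=> [Hab [C [s [Cproj sC HC]]]].
have [i [j [ij ji]]] := siso_trans HC (spec_fspec (FAlgebra s)).
have Caff : faffine (FAlgebra s) by apply: alg_scheme_affine.
have Nrefl := @qc_reflexive k C.
have Crefl : freflexive (FAlgebra s) by apply: reflexive_dual.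
pose D := conv_alg Hab Caff Crefl ij ji.
have DC : alg_commutative D by apply: convC.
have evN A B (g : calg_hom A B) (x : qc C A) :
    eval_dual (sf_map g x) = sf_map g (eval_dual x) by rewrite eval_dual_map.
pose theta : snat (qc C) (FAlgebra D) := @SNat k (qc C) (FAlgebra D) (@eval_dual k _) evN.
have [A [Aproj [u [uI uS]]]] := @qc_calg k C (FAlgebra D) DC theta
  (@eval_dualD k (qc C)) (@eval_dualZ k (qc C)) (fun B => proj1 (eval_dual_bij B Nrefl))
  (fun B => proj2 (eval_dual_bij B Nrefl)).
have Daff : faffine (FAlgebra D) := faffine_iso uI uS (@qc_alg_affine k A).
split; last by move=> B; split;
  [exact: bidual_unit_inj Daff _
  | exact: (@bidual_unit_surj k H (FAlgebra s) Hab sC _ _ _ _ _ _ Daff)].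
split; first exact: mdual_abelian.
exists A; split; first exact: Aproj.
apply: siso_trans (mdual_spec Hab Caff Crefl ij ji) _.
exact: siso_trans (fspec_iso uI uS) (siso_sym (spec_fspec _)).
Qed.

Lemma fmon_iso_bij (X Y : FMon k) (u : Defs.hom X Y) :
  (forall B, injective (fgh_nat u B)) ->
  (forall B y, exists x, fgh_nat u B x = y) -> isomorphism u.
Proof.
move=> uI uS; have [v [uK vK]] := snat_inverse uI uS.
have vM B x y : v B (gmul (fg_mon Y B) x y) = gmul (fg_mon X B) (v B x) (v B y).
  by apply: (uI B); rewrite fgh_mul !vK.
have v1 B : v B (gone (fg_mon Y B)) = gone (fg_mon X B).
  by apply: (uI B); rewrite fgh_one vK.
exists (FMonHom vM v1); split; apply: fmon_hom_eq => B x; [exact: uK | exact: vK].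
Qed.

Lemma bidual_unit_nat (X Y : FMon k) (f : Defs.hom X Y) :
  @compm (FMon k) _ _ _ (bidual_unit Y) f =
  @compm (FMon k) _ _ _ (mdual_hom (mdual_hom f)) (bidual_unit X).
Proof.
apply: fmon_hom_eq => B x; apply: fmon_hom_at_eq => S s chi /=.
by rewrite sn_nat.
Qed.
End Duality.

Theorem theorem1 (k : comPzRingType) :
  exists (dual_affine : forall G : FMon k,
            affine_monoid G -> alg_scheme_monoid (mdual_functor k G))
         (dual_scheme : forall H : FMon k,
            alg_scheme_monoid H -> affine_monoid (mdual_functor k H)),
    anti_equivalence (contra_restrict dual_affine)
                     (contra_restrict dual_scheme).
Proof.
exists (fun G GA => proj1 (affine_dual GA)), (fun H HC => proj1 (alg_scheme_dual HC)).
(* The map X -> X^** serves on both sides: it is natural on all functors of monoids and bijective on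
   the objects of either subcategory. *)
split; exists (fun X => bidual_unit (sval X)); split=> [X Y f|[X XP]].
- exact: bidual_unit_nat.
- have XB := proj2 (affine_dual XP).
  have [v [uv vu]] := @fmon_iso_bij k X (mdual (mdual X)) (bidual_unit X)
    (fun B => proj1 (XB B)) (fun B => proj2 (XB B)).
  by exists v.
- exact: bidual_unit_nat.
- have XB := proj2 (alg_scheme_dual XP).
  have [v [uv vu]] := @fmon_iso_bij k X (mdual (mdual X)) (bidual_unit X)
    (fun B => proj1 (XB B)) (fun B => proj2 (XB B)).
  by exists v.
Qed.
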